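(* Let $\mathcal{F}=(C_1,\ldots,C_n)$, $n\ge 4$, be an ordered family of pairwise disjoint compact convex sets in $\mathbb{R}^2$. For each $i$ let $f_{C_i}:\mathcal{C}(\mathbb{R}^2)\to\mathbb{R}$ be a monotone function, continuous with respect to the Hausdorff metric, and let $\alpha_{C_i}>0$. Suppose that for any four indices $i_1<i_2<i_3<i_4$ there is a directed line which is an $(f,\alpha)$-transversal of $C_{i_1},\ldots,C_{i_4}$ and meets them in the order $C_{i_1},\ldots,C_{i_4}$. Then there is a directed line which is an $(f,\alpha)$-transversal of all of $C_1,\ldots,C_n$ and meets them in the order $C_1,\ldots,C_n$.
   Context: $\mathcal{C}(\mathbb{R}^2)$ denotes the family of convex subsets of $\mathbb{R}^2$; $g$ is monotone if $K_1\subset K_2$ implies $g(K_1)\le g(K_2)$ (or always $g(K_1)\ge g(K_2)$). For a directed line $\ell$ and convex $C$, $\ell^+(C)$ (resp. $\ell^-(C)$) is the intersection of $C$ with the closed half-plane bounded by $\ell$ to the left (resp. right) of the direction of $\ell$. $\ell$ is an $(f,\alpha)$-stabber of $C_i$ if $f_{C_i}(\ell^+(C_i))\ge\alpha_{C_i}$ and $f_{C_i}(\ell^-(C_i))\ge\alpha_{C_i}$, and an $(f,\alpha)$-transversal of a subfamily if it is an $(f,\alpha)$-stabber of each of its members. A directed line meets $K_1,\ldots,K_m$ in the order $K_1,\ldots,K_m$ if there are points $p_j\in\ell\cap K_j$ appearing along $\ell$ in the order $p_1,\ldots,p_m$ with respect to the direction of $\ell$. *)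

(* Defs.v *)
From HB Require Import structures.
From mathcomp Require Import all_boot all_order all_algebra.
From mathcomp Require Import all_classical all_reals all_analysis.

Set Implicit Arguments.
Unset Strict Implicit.
Unset Printing Implicit Defensive.

Import Order.TTheory GRing.Theory Num.Theory.
Import numFieldNormedType.Exports.

Local Open Scope classical_set_scope.
Local Open Scope ring_scope.

Section Plane.
Context {R : realType}.
Implicit Types (x u v : 'rV[R]_2) (A B C K : set 'rV[R]_2).
Implicit Types (g : set 'rV[R]_2 -> R).

(* The library norm on matrices is the sup norm. *)
Definition euclid_norm x : R := Num.sqrt (x 0 0 ^+ 2 + x 0 1 ^+ 2).

Definition cross u v : R := u 0 0 * v 0 1 - u 0 1 * v 0 0.

(* The Hausdorff distance on arbitrary sets takes the value +oo, e.g. between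
   set0 and a nonempty set. The outer max only matters for A = B = set0, where
   both suprema are -oo. *)
Definition hausdorff_dist A B : \bar R :=
  maxe 0%E
    (maxe
      (ereal_sup [set ereal_inf [set (euclid_norm (x - y))%:E | y in B]
                 | x in A])
      (ereal_sup [set ereal_inf [set (euclid_norm (x - y))%:E | x in A]
                 | y in B])).

(* Functions on the family of convex sets are represented by functions on all
   sets, whose values at non-convex sets are left unconstrained. *)
Definition convex_monotone g : Prop :=
  (forall K1 K2, convex_set K1 -> convex_set K2 -> K1 `<=` K2 -> g K1 <= g K2)
  \/
  (forall K1 K2, convex_set K1 -> convex_set K2 -> K1 `<=` K2 -> g K2 <= g K1).

Definition hausdorff_continuous g : Prop :=
  forall K, convex_set K -> forall e : R, 0 < e ->
  exists2 d : R, 0 < d &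
    forall K', convex_set K' -> (hausdorff_dist K K' < d%:E)%E ->
      `|g K - g K'| < e.

End Plane.

Record directed_line (R : realType) := DirectedLine {
  dl_base : 'rV[R]_2;
  dl_dir : 'rV[R]_2;
  dl_dir_neq0 : dl_dir != 0 }.

Section Transversals.
Context {R : realType}.
Implicit Types (l : directed_line R) (C : set 'rV[R]_2).

Definition dl_point l (t : R) : 'rV[R]_2 := dl_base l + t *: dl_dir l.

Definition left_part l C : set 'rV[R]_2 :=
  C `&` [set x | 0 <= cross (dl_dir l) (x - dl_base l)].

Definition right_part l C : set 'rV[R]_2 :=
  C `&` [set x | cross (dl_dir l) (x - dl_base l) <= 0].

Definition fa_stabber (f : set 'rV[R]_2 -> R) (alpha : R) C l : Prop :=
  alpha <= f (left_part l C) /\ alpha <= f (right_part l C).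

Definition fa_transversal (m : nat) (f : 'I_m -> set 'rV[R]_2 -> R)
    (alpha : 'I_m -> R) (K : 'I_m -> set 'rV[R]_2) l : Prop :=
  forall j, fa_stabber (f j) (alpha j) (K j) l.

(* The witnesses are the points dl_point l (t j). *)
Definition meets_in_order (m : nat) (K : 'I_m -> set 'rV[R]_2) l : Prop :=
  exists t : 'I_m -> R,
    (forall j, K j (dl_point l (t j))) /\
    (forall j k : 'I_m, (j < k)%N -> t j < t k).

End Transversals.

(* Main.v *)
(** For a direction [u], the lines directed by [u] that stab [C_i] form an
interval of parallel lines, and a stabber can be rotated about any point outside
of [C_i] until it leaves too little on one side.

Directions of lines meeting [C_i] before [C_j] form an arc [D_ij] shorter than a
half turn.  If every four indices admit a direction common to their arcs, so do
all of them: by induction pick [k_a] common to all arcs not involving [a]; any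
three of five such directions lie in one arc, so the five are linearly ordered,
each [D_ij] contains at least three of them, and hence it contains the median.
Let [K] be the (closed) intersection of all the arcs.

Suppose that no direction [u] in [K] has a common stabber.  Then either

- for some [p < q] all the ordered stabbers of the pair turn strictly right of
  [u], or
- for some [p < q] they all turn strictly left of [u], or
- some [C_i] has no stabber directed by [u], while for each [k] the pair [i, k]
  has stabbers on both sides of [u].

Rotation makes all three conditions open, and the four-set hypothesis makes them
exclusive.  The first and the third fail at one end of [K] and the second at the
other, which contradicts the connectedness of [K].

Closedness of the set of stabbers, used throughout, fails only for a decreasing
[f_i] and a degenerate [C_i], contained in the candidate line.  One then works
with the closure, and if the line found is not a true stabber of some [C_p], it
is rotated slightly about a point of [C_p]; the sense of rotation is the same for
all the other sets, because any two of them have a stabber in common with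
[C_p]. *)

Require Import Defs.
From mathcomp Require Import all_boot all_order all_algebra.
From mathcomp Require Import all_classical all_reals all_analysis.
From mathcomp Require Import zify ring lra.

Import Order.TTheory GRing.Theory Num.Theory.
Import numFieldNormedType.Exports.

Set Implicit Arguments.
Unset Strict Implicit.
Unset Printing Implicit Defensive.

Local Open Scope classical_set_scope.
Local Open Scope ring_scope.

(** * Planar directions *)

Section PlaneGeometry.
Context {R : realType}.
Implicit Types (u v w x y z : 'rV[R]_2) (a b c : R).

Lemma rV2_eq u v : u 0 0 = v 0 0 -> u 0 1 = v 0 1 -> u = v.
Proof.
move=> e0 e1; apply/rowP => i.
have [->|->] : i = 0 \/ i = 1.
  by case: i => -[|[|//]] ?; [left|right]; apply/val_inj.
- exact: e0.
- exact: e1.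
Qed.

(** * The determinant of two plane vectors *)

Lemma crossDl u v w : cross (u + v) w = cross u w + cross v w.
Proof. by rewrite /cross !mxE; ring. Qed.
Lemma crossDr u v w : cross u (v + w) = cross u v + cross u w.
Proof. by rewrite /cross !mxE; ring. Qed.
Lemma crossNl u v : cross (- u) v = - cross u v.
Proof. by rewrite /cross !mxE; ring. Qed.
Lemma crossNr u v : cross u (- v) = - cross u v.
Proof. by rewrite /cross !mxE; ring. Qed.
Lemma crossZl a u v : cross (a *: u) v = a * cross u v.
Proof. by rewrite /cross !mxE; ring. Qed.
Lemma crossZr a u v : cross u (a *: v) = a * cross u v.
Proof. by rewrite /cross !mxE; ring. Qed.
Lemma crossC u v : cross u v = - cross v u.
Proof. by rewrite /cross; ring. Qed.
Lemma crossvv u : cross u u = 0.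
Proof. by rewrite /cross; ring. Qed.
Lemma cross0l u : cross 0 u = 0.
Proof. by rewrite /cross !mxE; ring. Qed.
Lemma cross0r u : cross u 0 = 0.
Proof. by rewrite /cross !mxE; ring. Qed.

Definition crossE := (crossDl, crossDr, crossNl, crossNr, crossZl, crossZr,
  crossvv, cross0l, cross0r).

Lemma cross_triple u v w :
  cross v w *: u + cross w u *: v + cross u v *: w = 0.
Proof. by apply: rV2_eq; rewrite /cross !mxE; ring. Qed.

Lemma cross_eq0P u v : u != 0 -> cross u v = 0 -> exists k, v = k *: u.
Proof.
move=> u0 uv0; pose n := u 0 0 ^+ 2 + u 0 1 ^+ 2.
have n0 : n != 0.
  apply: contra u0 => /eqP n0; apply/eqP.
  by apply: rV2_eq; rewrite mxE; move: n0; rewrite /n; nra.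
exists ((u 0 0 * v 0 0 + u 0 1 * v 0 1) / n).
move: uv0; rewrite /cross => uv0.
apply: rV2_eq; rewrite !mxE; apply: (mulIf n0); rewrite [RHS]mulrAC divfK //.
  apply/eqP; rewrite -subr_eq0 -[X in _ == X](mulr0 (- u 0 1)) -uv0 /n.
  by apply/eqP; ring.
apply/eqP; rewrite -subr_eq0 -[X in _ == X](mulr0 (u 0 0)) -uv0 /n.
by apply/eqP; ring.
Qed.

Lemma cross_neq0P u : u != 0 -> exists2 w : 'rV[R]_2, w != 0 & cross u w = 1.
Proof.
move=> u0; have n0 : u 0 0 ^+ 2 + u 0 1 ^+ 2 != 0.
  apply: contra u0 => /eqP n0; apply/eqP.
  by apply: rV2_eq; rewrite mxE; nra.
(* The quarter turn of [u], divided by the squared length of [u]. *)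
pose w := (u 0 0 ^+ 2 + u 0 1 ^+ 2)^-1 *:
  (\row_(j < 2) (if j == 0 then - u 0 1 else u 0 0) : 'rV[R]_2).
have uw : cross u w = 1 by rewrite /w crossZr /cross !mxE /=; field.
exists w => //; apply/eqP => w0; move/eqP: uw.
by rewrite w0 cross0r eq_sym oner_eq0.
Qed.

(* Convex cones without apex; these model arcs of directions shorter than a
   half turn. *)
Definition pointed_cone (D : set 'rV[R]_2) :=
  ~ D 0 /\ forall u v a b, D u -> D v -> 0 <= a -> 0 <= b -> 0 < a + b ->
    D (a *: u + b *: v).

Lemma pointed_coneZ D u a : pointed_cone D -> D u -> 0 < a -> D (a *: u).
Proof.
move=> [_ cD] Du a0; have := cD u u a 0 Du Du (ltW a0) (lexx _).
by rewrite scale0r !addr0; apply.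
Qed.

(** Were [cross u w] negative, the relation [cross_triple] would have nonnegative coefficients, one
    of them positive, and would put the apex in [D]. *)
Lemma cross_cone_trans D u v w : pointed_cone D -> D u -> D v -> D w ->
  0 <= cross u v -> 0 <= cross v w -> 0 <= cross u w.
Proof.
move=> pD Du Dv Dw uv vw; rewrite leNgt; apply/negP => uw.
have wu : 0 < cross w u by rewrite crossC oppr_gt0.
have [D0 cD] := pD; apply: D0; rewrite -(cross_triple u v w).
have Duv : D (cross v w *: u + cross w u *: v).
  by apply: cD => //; [exact: ltW|lra].
by rewrite -[X in X + _]scale1r; apply: cD => //; lra.
Qed.

(** Inside [D'], [v] lies between [u] and [w]. It is an explicit nonnegative combination of them
    when [cross u w] is positive; otherwise [v] and [w] are positive multiples of [u], because [D']
    omits the apex. *)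
Lemma cone_between D D' u v w : pointed_cone D' -> D' u -> D' v -> D' w ->
  0 <= cross u v -> 0 <= cross v w ->
  pointed_cone D -> D u -> D w -> D v.
Proof.
move=> pD' Du' Dv' Dw' uv vw pD Du Dw.
have v0 : v != 0 by apply/eqP => v0; move: Dv'; rewrite v0; case: pD'.
have := cross_cone_trans pD' Du' Dv' Dw' uv vw.
rewrite le_eqVlt => /orP[/eqP uw0|uw]; last first.
  have -> : v = (cross v w / cross u w) *: u + (cross u v / cross u w) *: w.
    move: (lt0r_neq0 uw); rewrite /cross => uw0.
    by apply: rV2_eq; rewrite !mxE; field.
  have [_ cD] := pD; apply: cD => //; rewrite ?divr_ge0 ?(ltW uw) //.
  rewrite -mulrDl divr_gt0 // lt_neqAle addr_ge0 // andbT eq_sym.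
  rewrite paddr_eq0 //; apply/negP => /andP[/eqP vw0 /eqP uv0].
  have [k wk] := cross_eq0P v0 vw0.
  have [|l ul] := @cross_eq0P v u v0; first by rewrite crossC uv0 oppr0.
  by move: uw; rewrite wk ul !crossE; lra.
have u0 : u != 0 by apply/eqP => u0; move: Du'; rewrite u0; case: pD'.
have [k wk] := cross_eq0P u0 (esym uw0).
have k0 : 0 < k.
  rewrite ltNge; apply/negP => k0; case: pD' => D0 cD; apply: D0.
  have := cD u w (- k) 1 Du' Dw'; rewrite wk scale1r scaleNr addNr.
  by apply; lra.
have uv0 : cross u v = 0.
  apply/eqP; rewrite eq_le uv andbT.
  by move: vw; rewrite wk crossZr crossC; nra.
have [l vl] := cross_eq0P u0 uv0.
have l0 : 0 < l.
  rewrite ltNge; apply/negP => l0; case: pD' => D0 cD; apply: D0.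
  have := cD u v (- l) 1 Du' Dv'; rewrite vl scale1r scaleNr addNr.
  by apply; lra.
by rewrite vl; apply: pointed_coneZ.
Qed.

(* The vectors [k a] common to the cones that avoid a given index [a] are
   linearly ordered by angle, and the median of five of them lies in all the
   cones, as every cone contains all but two of them. *)
Lemma cone_helly (n : nat) (D : 'I_n -> 'I_n -> set 'rV[R]_2) :
  (forall i j : 'I_n, (i < j)%N -> pointed_cone (D i j)) ->
  (forall A : {set 'I_n}, #|A| = 4 ->
    exists u, forall i j, i \in A -> j \in A -> (i < j)%N -> D i j u) ->
  forall A : {set 'I_n}, (4 <= #|A|)%N ->
    exists u, forall i j, i \in A -> j \in A -> (i < j)%N -> D i j u.
Proof.
move=> pD D4 A; move: {2}#|A| (erefl #|A|) => m; elim: m A => [|m IH] A Am.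
  by rewrite Am.
rewrite leq_eqVlt => /orP[/eqP/esym/D4//|]; rewrite Am ltnS => m4.
have /choice[k kP] (a : 'I_n) : exists u, a \in A -> forall i j,
    i \in A -> j \in A -> i != a -> j != a -> (i < j)%N -> D i j u.
  have [aA|] := boolP (a \in A); last by exists 0.
  have Aa : #|A :\ a| = m by move: Am; rewrite (cardsD1 a) aA add1n => -[].
  have [|u uP] := IH _ Aa; first by rewrite Aa.
  exists u => _ i j iA jA ia ja; apply: uP.
  - by rewrite !inE ia.
  - by rewrite !inE ja.
(* At least five indices less three leave a pair [i < j], and all three vectors were chosen in its
   cone. *)
have common (a b c : 'I_n) : a \in A -> b \in A -> c \in A ->
    exists i j, [/\ pointed_cone (D i j), D i j (k a), D i j (k b)
                  & D i j (k c)].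
  move=> aA bA cA.
  have : (1 < #|A :\ a :\ b :\ c|)%N.
    have := cardsD1 a A; have := cardsD1 b (A :\ a).
    have := cardsD1 c (A :\ a :\ b); rewrite Am aA add1n.
    move=> e1 e2 [e3]; move: m4; rewrite e3 e2 e1.
    by case: (b \in _); case: (c \in _); rewrite ?add0n ?add1n ?ltnS // => /ltnW // /ltnW.
  case/card_gt1P => i [j []]; rewrite !inE.
  move=> /and4P[ic ib ia iA] /and4P[jc jb ja jA] ij.
  wlog lij : i j iA jA ia ib ic ja jb jc ij / (i < j)%N.
    move=> H; case: (ltngtP i j) => [?|?|/val_inj e].
    - exact: (H i j).
    - by apply: (H j i) => //; rewrite eq_sym.
    - by rewrite e eqxx in ij.
  by exists i, j; split; [exact: pD| apply: kP..].
pose r (a b : 'I_n) := 0 <= cross (k a) (k b).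
have rtot : {in A &, total r}.
  by move=> a b _ _; rewrite /r (crossC (k b)) oppr_ge0; exact: le_total.
have rtrans : {in A & &, transitive r}.
  move=> b a c bA aA cA; have [i [j [p Da Db Dc]]] := common a b c aA bA cA.
  exact: (cross_cone_trans p Da Db Dc).
have all5 : all [in A] (take 5 (enum A)).
  by apply/allP => x /mem_take; rewrite mem_enum.
have s5 : size (sort r (take 5 (enum A))) = 5.
  by rewrite size_sort size_takel // -cardE Am.
have us : uniq (sort r (take 5 (enum A))).
  by rewrite sort_uniq take_uniq // enum_uniq.
have ss : sorted r (sort r (take 5 (enum A))).
  exact: (sort_sorted_in rtot).
have sA : all [in A] (sort r (take 5 (enum A))) by rewrite all_sort.
move: (sort r _) s5 us ss sA => -[|s1 [|s2 [|s3 [|s4 [|s5 []]]]]] //= _.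
rewrite !inE !negb_or !andbT.
move=> /and4P[/and4P[d12 d13 d14 d15] /and3P[d23 d24 d25] /andP[d34 d35] d45].
move=> /and4P[r12 r23 r34 r45] /and5P[A1 A2 A3 A4 A5].
have r13 := rtrans _ _ _ A2 A1 A3 r12 r23.
have r35 := rtrans _ _ _ A4 A3 A5 r34 r45.
exists (k s3) => i j iA jA ij.
have mid (a b : 'I_n) : a \in A -> b \in A -> r a s3 -> r s3 b -> i != a -> j != a ->
    i != b -> j != b -> D i j (k s3).
  move=> aA bA ra rb ia ja ib jb.
  have [p [q [pp Dp D3 Dq]]] := common a s3 b aA A3 bA.
  by apply: (cone_between pp Dp D3 Dq ra rb (pD _ _ ij)); apply: kP.
(* If [s3] is neither [i] nor [j], then [k s3] was chosen in the cone. Otherwise the other index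
   spoils at most one of the remaining four vectors, and one is left on each side of [k s3]. *)
have [i3|i3] := eqVneq i s3.
  have [j1|j1] := eqVneq j s1.
    by apply: (mid s2 s4) => //; rewrite ?i3 ?j1 // eq_sym.
  have [j4|j4] := eqVneq j s4.
    by apply: (mid s1 s5) => //; rewrite ?i3 ?j4 // eq_sym.
  by apply: (mid s1 s4) => //; rewrite ?i3 // eq_sym.
have [j3|j3] := eqVneq j s3; last exact: kP.
have [i1|i1] := eqVneq i s1.
  by apply: (mid s2 s4) => //; rewrite ?j3 ?i1 // eq_sym.
have [i4|i4] := eqVneq i s4.
  by apply: (mid s1 s5) => //; rewrite ?j3 ?i4 // eq_sym.
by apply: (mid s1 s4) => //; rewrite ?j3 // eq_sym.
Qed.

End PlaneGeometry.

(** * Compactness and convexity in the plane *)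

(** The tube lemma. *)
Lemma compact_near (X T : topologicalType) (K : set X) (t0 : T)
    (P : T -> X -> Prop) : compact K ->
  (forall x, K x -> \forall z \near (x, t0), P z.2 z.1) ->
  \forall t \near t0, forall x, K x -> P t x.
Proof.
by move=> /compact_near_coveringP cK KP; apply: (cK _ (nbhs t0) P) => x /KP.
Qed.

Section PlaneTopology.
Context {R : realType}.
Implicit Types (u v w x y z p : 'rV[R]_2) (c e s : R) (C : set 'rV[R]_2).

Lemma convex_setP C : convex_set C <->
  forall x y s, C x -> C y -> 0 <= s -> s <= 1 -> C (s *: x + (1 - s) *: y).
Proof.
split=> [cC x y s Cx Cy s0 s1|cC x y s /set_mem Cx /set_mem Cy].
  by have := cC x y (Itv01 s0 s1); rewrite !inE; apply.
by apply/mem_set; apply: cC.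
Qed.

Lemma convex_cross_ivt C u x y c : convex_set C -> C x -> C y ->
  cross u x <= c -> c <= cross u y ->
  exists s, [/\ 0 <= s, s <= 1, C (s *: x + (1 - s) *: y)
              & cross u (s *: x + (1 - s) *: y) = c].
Proof.
move=> /convex_setP cC Cx Cy xc cy.
have [e|ne] := eqVneq (cross u x) (cross u y).
  exists 1; rewrite ler01 lexx; split => //; first exact: cC.
  by rewrite !crossE; lra.
have lt : 0 < cross u y - cross u x.
  by rewrite subr_gt0 lt_neqAle ne (le_trans xc).
have s0 : 0 <= (cross u y - c) / (cross u y - cross u x).
  by rewrite divr_ge0 ?(ltW lt) // subr_ge0.
have s1 : (cross u y - c) / (cross u y - cross u x) <= 1.
  by rewrite ler_pdivrMr // mul1r lerB.
exists ((cross u y - c) / (cross u y - cross u x)); split => //.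
  exact: cC.
rewrite !crossE; have : cross u y - cross u x != 0 by rewrite gt_eqF.
by move=> ?; field.
Qed.

Lemma cvg_cross (T : Type) (F : set_system T) {FF : Filter F}
    (f g : T -> 'rV[R]_2) u v :
  f @ F --> u -> g @ F --> v -> cross (f t) (g t) @[t --> F] --> cross u v.
Proof.
move=> fu gv.
have fc j : f t 0 j @[t --> F] --> u 0 j.
  by apply: (cvg_comp f (fun x => x 0 j) fu); exact: coord_continuous.
have gc j : g t 0 j @[t --> F] --> v 0 j.
  by apply: (cvg_comp g (fun x => x 0 j) gv); exact: coord_continuous.
by apply: cvgB; apply: cvgM.
Qed.

Lemma near_cross_lt (T : Type) (F : set_system T) {FF : Filter F}
    (f g : T -> 'rV[R]_2) u v c :
  f @ F --> u -> g @ F --> v -> cross u v < c ->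
  \forall t \near F, cross (f t) (g t) < c.
Proof.
by move=> fu gv; exact: (cvgr_lt (cross u v) (cvg_cross fu gv)).
Qed.

Lemma near_cross_gt (T : Type) (F : set_system T) {FF : Filter F}
    (f g : T -> 'rV[R]_2) u v c :
  f @ F --> u -> g @ F --> v -> c < cross u v ->
  \forall t \near F, c < cross (f t) (g t).
Proof.
by move=> fu gv; exact: (cvgr_gt (cross u v) (cvg_cross fu gv)).
Qed.

Lemma cross_continuous u : continuous (fun x => cross u x).
Proof.
move=> x; have h := @cvg_cross _ _ (nbhs_filter x) (fun=> u) id u x.
apply: h; last exact: cvg_id.
exact: (cvg_cst u).
Qed.

Lemma compact_cross_min C u : compact C -> C !=set0 ->
  exists2 x, C x & forall y, C y -> cross u x <= cross u y.
Proof.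
move=> cC C0; have [|x xC xmin] := compact_EVT_min C0 cC (f := fun x => cross u x).
  by apply: continuous_subspaceT; exact: cross_continuous.
by exists x; [exact: set_mem|move=> y Cy; apply: xmin; exact: mem_set].
Qed.

Lemma compact_cross_bounded C u : compact C ->
  exists M, forall x, C x -> `|cross u x| <= M.
Proof.
move=> cC; have [C0|/set0P/negP/negPn/eqP ->] := pselect (C !=set0); last by exists 0.
have [x _ xm] := compact_cross_min u cC C0.
have [y _ ym] := compact_cross_min (- u) cC C0.
exists (`|cross u x| + `|cross u y|) => z Cz.
move: (xm z Cz) (ym z Cz); rewrite !crossNl lerN2 => xz zy.
by rewrite ler_norml; apply/andP; split;
  have := ler_norm (cross u y); have := ler_norm (- cross u x);
  have := normr_ge0 (cross u x); have := normr_ge0 (cross u y);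
  rewrite normrN; lra.
Qed.

(** Connectedness of the segment, for a relatively clopen property holding at [a]. *)
Lemma segment_clopen (a b : R) (X : R -> Prop) : a <= b -> X a ->
  (forall t, a <= t <= b -> X t -> \forall t' \near t, X t') ->
  (forall t, a <= t <= b -> ~ X t -> \forall t' \near t, a <= t' <= b -> ~ X t') -> X b.
Proof.
move=> ab Xa oX cX.
suff e : `[a, b]%classic `&` X = `[a, b]%classic.
  by have : `[a, b]%classic b; [rewrite /= in_itv /= lexx andbT|rewrite -e => -[]].
have aab : `[a, b]%classic a by rewrite /= in_itv /= lexx.
apply: segment_connected.
- by exists a.
- exists (interior [set t | a <= t <= b -> X t]); first exact: open_interior.
  apply/seteqP; split => t [/= tab Xt]; split => //.
    rewrite in_itv /= in tab; have := oX t tab Xt.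
    by apply: filterS => t' Xt' _.
  by rewrite in_itv /= in tab; have := interior_subset Xt; apply.
- exists (~` interior [set t | a <= t <= b -> ~ X t]).
    by rewrite closedC; exact: open_interior.
  apply/seteqP; split => t [/= tab Xt]; split => //.
    by move=> /interior_subset /=; rewrite in_itv /= in tab => /(_ tab).
  rewrite in_itv /= in tab; apply: contrapT => nX; apply: Xt.
  exact: cX.
Qed.

End PlaneTopology.

(** * Side conditions *)

Section SideConditions.
Context {R : realType}.
Implicit Types (u v w x y z p : 'rV[R]_2) (c e s : R) (C : set 'rV[R]_2)
  (Ok : 'rV[R]_2 -> R -> Prop).

(* A pair [(u, c)] with [u != 0] stands for the line [cross u x = c] directed
   by [u], and [(- u, - c)] for the same line with the opposite direction;
   [Ok u c] says that the part of [C] to the right of the line is not too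
   small. *)
Definition stab Ok u c := Ok u c /\ Ok (- u) (- c).

Definition side_meets C Ok := forall u c, Ok u c -> exists2 x, C x & cross u x <= c.

(* A stabber can be rotated about any point outside of [C]. *)
Definition side_rotates C Ok := forall u c u' c' p, u != 0 -> u' != 0 ->
  stab Ok u' c' -> C p -> cross u' p = c' -> cross u p <= c ->
  (cross u u' != 0 -> forall q, C q -> cross u q = c -> cross u' q <> c') ->
  Ok u c.

(** Lines are compared through their affine forms on [C] only, since all that matters is how they
    divide [C]. *)
Definition ok_limit C Ok u c := forall e, 0 < e -> exists u' c', Ok u' c' /\
  forall x, C x -> `|(cross u' x - c') - (cross u x - c)| <= e.

(** Limits are asked for on both sides: for a decreasing function one side alone does not control a
    set lying entirely to one side of the limit line. *)
Definition side_closed C Ok := forall u c, u != 0 ->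
  ok_limit C Ok u c -> ok_limit C Ok (- u) (- c) -> Ok u c.

Lemma stabN Ok u c : stab Ok u c -> stab Ok (- u) (- c).
Proof. by case=> ? ?; split; rewrite ?opprK. Qed.

Lemma stab_meets C Ok u c : convex_set C -> side_meets C Ok -> stab Ok u c ->
  exists2 x, C x & cross u x = c.
Proof.
move=> cC mC [/mC[x Cx xc] /mC[y Cy]]; rewrite crossNl lerN2 => yc.
by have [s [_ _ ? ?]] := convex_cross_ivt cC Cx Cy xc yc; eexists; eauto.
Qed.

Lemma stab_parallel C Ok u v c x : side_rotates C Ok -> u != 0 -> v != 0 ->
  cross v u = 0 -> C x -> cross u x = c -> stab Ok u c ->
  stab Ok v (cross v x).
Proof.
move=> rC u0 v0 vu Cx xc uc; split.
  by apply: (rC _ _ u c x) => //; rewrite vu eqxx.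
by apply: (rC _ _ u c x); rewrite ?crossNl ?vu ?oppr0 ?oppr_eq0 ?eqxx.
Qed.

Lemma side_closed_stab C Ok u c : side_closed C Ok -> u != 0 ->
  ok_limit C Ok u c -> ok_limit C Ok (- u) (- c) -> stab Ok u c.
Proof.
move=> cl u0 l1 l2; split; first exact: cl.
by apply: cl; rewrite ?oppr_eq0 ?opprK.
Qed.

Lemma near_uniform_on_compact (T : topologicalType) (t0 : T) C
    (U : T -> 'rV[R]_2) (g : T -> R) e : compact C ->
  U t @[t --> t0] --> U t0 -> g t @[t --> t0] --> g t0 -> 0 < e ->
  \forall t \near t0, forall x, C x ->
    `|(cross (U t) x - g t) - (cross (U t0) x - g t0)| <= e.
Proof.
move=> cC Ut gt e0.
apply: ((compact_near_coveringP C).1 cC _ (nbhs t0)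
  (fun t x => `|(cross (U t) x - g t) - (cross (U t0) x - g t0)| <= e)) => x Cx.
have UF : U z.2 @[z --> filter_prod (nbhs x) (nbhs t0)] --> U t0.
  by apply: (cvg_comp snd U) Ut; exact: cvg_snd.
have gF : g z.2 @[z --> filter_prod (nbhs x) (nbhs t0)] --> g t0.
  by apply: (cvg_comp snd g) gt; exact: cvg_snd.
have xF : z.1 @[z --> filter_prod (nbhs x) (nbhs t0)] --> x.
  exact: cvg_fst.
have cF : U t0 @[z --> filter_prod (nbhs x) (nbhs t0)] --> U t0.
  exact: cvg_cst.
have dF : g t0 @[z --> filter_prod (nbhs x) (nbhs t0)] --> g t0.
  exact: cvg_cst.
have l2 : (cross (U z.2) z.1 - g z.2 - (cross (U t0) z.1 - g t0))
    @[z --> filter_prod (nbhs x) (nbhs t0)] --> (0 : R).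
  rewrite -(subrr (cross (U t0) x - g t0)).
  by apply: cvgB; apply: cvgB => //; exact: cvg_cross.
exact: (cvgr0_norm_le _ l2).
Qed.

(** Compactness of [C] turns convergence of the coefficients into uniform convergence on [C], so
    stabbers arbitrarily close to [t0] would make the limit line a stabber. *)
Lemma near_not_stab (T : topologicalType) (t0 : T) C Ok
    (U : T -> 'rV[R]_2) (g : T -> R) : compact C -> side_closed C Ok ->
  U t0 != 0 -> U t @[t --> t0] --> U t0 -> g t @[t --> t0] --> g t0 ->
  ~ stab Ok (U t0) (g t0) -> \forall t \near t0, ~ stab Ok (U t) (g t).
Proof.
move=> cC cl u0 Ut gt ns; apply: contrapT => nnear; apply: ns.
have L e : 0 < e -> exists2 t, stab Ok (U t) (g t) & forall x, C x ->
    `|(cross (U t) x - g t) - (cross (U t0) x - g t0)| <= e.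
  move=> e0; apply: contrapT => nex; apply: nnear.
  have := near_uniform_on_compact cC Ut gt e0.
  by apply: filterS => t tP st; apply: nex; exists t.
apply: (side_closed_stab cl) => // e /L[t [s1 s2] tP].
  by exists (U t), (g t).
exists (- U t), (- g t); split => // x /tP.
by rewrite !crossNl -!opprD normrN.
Qed.

(** The cone spanned by the differences [y - x]: the arc of directions of lines meeting [A] before
    [B]. *)
Definition dir_cone (A B : set 'rV[R]_2) : set 'rV[R]_2 :=
  [set u | exists x y k, [/\ A x, B y, 0 < k & u = k *: (y - x)]].

Lemma dir_cone_pointed (A B : set 'rV[R]_2) : convex_set A -> convex_set B ->
  A `&` B = set0 -> pointed_cone (dir_cone A B).
Proof.
move=> /convex_setP cA /convex_setP cB AB; split.
  move=> [x [y [k [Ax By k0 /eqP]]]]; rewrite eq_sym scaler_eq0 gt_eqF //=.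
  rewrite subr_eq0 => /eqP e; have : (A `&` B) x by split=> //; rewrite -e.
  by rewrite AB.
move=> _ _ a b [x [y [k [Ax By k0 ->]]]] [x' [y' [k' [Ax' By' k0' ->]]]] a0 b0 ab.
have K0 : 0 < a * k + b * k'.
  have [a1|a1] := ltrP 0 a.
    by rewrite ltr_wpDr ?mulr_gt0 // mulr_ge0 // ltW.
  by rewrite ltr_wpDl ?mulr_gt0 ?mulr_ge0 ?(ltW k0) //; lra.
(* Weights proportional to [a * k] and [b * k'] merge the two differences into one. *)
pose s := a * k / (a * k + b * k').
have s1 : 1 - s = b * k' / (a * k + b * k') by rewrite /s; field; rewrite gt_eqF.
have s0 : 0 <= s by rewrite divr_ge0 ?(ltW K0) // mulr_ge0 // ltW.
have sl1 : s <= 1.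
  by rewrite -subr_ge0 s1 divr_ge0 ?(ltW K0) // mulr_ge0 // ltW.
exists (s *: x + (1 - s) *: x'), (s *: y + (1 - s) *: y'), (a * k + b * k').
split=> //; [exact: cA|exact: cB|].
apply: rV2_eq; rewrite !mxE s1 /s; field; by rewrite gt_eqF.
Qed.

(** Were [y - x] a nonpositive multiple of [u], the cone would contain both and so its apex. Thus a
    line directed by an element of the cone meets the two sets in the right order, whichever points
    are chosen. *)
Lemma dir_cone_stab (A B : set 'rV[R]_2) u x y : pointed_cone (dir_cone A B) ->
  dir_cone A B u -> A x -> B y -> cross u x = cross u y ->
  exists2 k, 0 < k & y - x = k *: u.
Proof.
move=> pD Du Ax By uxy.
have u0 : u != 0 by apply/eqP => u0; move: Du; rewrite u0; case: pD.
have [|k kE] := @cross_eq0P _ u (y - x) u0.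
  by rewrite !crossE uxy subrr.
exists k => //.
have Dxy : dir_cone A B (y - x) by exists x, y, 1; rewrite scale1r.
rewrite ltNge; apply/negP => k0; case: pD => D0 cD; apply: D0.
have -> : 0 = (- k) *: u + 1 *: (y - x) by rewrite kE scale1r scaleNr addNr.
by apply: cD => //; lra.
Qed.

Lemma disjoint_neq (A B : set 'rV[R]_2) x y : A `&` B = set0 -> A x -> B y ->
  y - x != 0.
Proof.
move=> AB Ax By; rewrite subr_eq0; apply/eqP => e.
by have : (A `&` B) x; [split=> //; rewrite -e|rewrite AB].
Qed.

Lemma compact_convex_separation (A B : set 'rV[R]_2) : compact A -> compact B ->
  convex_set A -> convex_set B -> A `&` B = set0 -> A !=set0 -> B !=set0 ->
  exists (h : 'rV[R]_2) (d : R), [/\ h != 0, 0 < d &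
    forall x y, A x -> B y -> d <= cross h (y - x)].
Proof.
move=> cA cB /convex_setP vA /convex_setP vB AB [a Aa] [b Bb].
pose q (m : 'rV[R]_2) := m 0 0 ^+ 2 + m 0 1 ^+ 2.
have [||[x y]] := compact_EVT_min _ (compact_setX cA cB)
    (f := fun z : 'rV[R]_2 * 'rV[R]_2 => q (z.2 - z.1)).
- by exists (a, b).
- apply: continuous_subspaceT => z.
  pose f (z' : 'rV[R]_2 * 'rV[R]_2) : 'rV[R]_2 := z'.2 - z'.1.
  have fz : f @ z --> f z by apply: cvgB; [exact: cvg_snd|exact: cvg_fst].
  have coord (j : 'I_2) : f z' 0 j @[z' --> z] --> f z 0 j.
    by apply: (cvg_comp f (fun x => x 0 j) fz); exact: coord_continuous.
  by apply: cvgD; rewrite /= expr2; under eq_fun do rewrite expr2; apply: cvgM; exact: coord.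
rewrite inE => -[/= Ax By] mn.
have m0 := disjoint_neq AB Ax By.
set m := y - x in m0 mn.
have q0 : 0 < q m.
  rewrite lt_neqAle addr_ge0 ?sqr_ge0 // andbT eq_sym; apply: contra m0.
  rewrite /q paddr_eq0 ?sqr_ge0 // !sqrf_eq0 => /andP[/eqP e0 /eqP e1].
  by apply/eqP/rV2_eq; rewrite [RHS]mxE.
(* For a closest pair with difference [m], [h] is [m] turned by a quarter, so that [cross h] is the
   scalar product with [m]. *)
exists (\row_(j < 2) (if j == 0 then m 0 1 else - m 0 0)), (q m).
have crE v : cross (\row_(j < 2) (if j == 0 then m 0 1 else - m 0 0)) v
   = m 0 0 * v 0 0 + m 0 1 * v 0 1.
  by rewrite /cross !mxE /=; ring.
split=> //.
  apply/eqP => h0; have := crE m; rewrite h0 cross0l => e.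
  by move: q0; rewrite /q !expr2 -e ltxx.
move=> x' y' Ax' By'; rewrite crE.
set d := y' - x'.
rewrite leNgt; apply/negP => lt.
have h s : 0 <= s -> s <= 1 -> q m <= q (m + s *: (d - m)).
  move=> s0 s1; have := mn (s *: x' + (1 - s) *: x, s *: y' + (1 - s) *: y).
  rewrite inE; have -> : m + s *: (d - m) = (s *: y' + (1 - s) *: y) - (s *: x' + (1 - s) *: x).
    by apply: rV2_eq; rewrite /m /d !mxE; ring.
  by apply; split; [exact: vA|exact: vB].
pose A1 := q m - (m 0 0 * d 0 0 + m 0 1 * d 0 1).
pose B1 := q (d - m).
have A0 : 0 < A1 by rewrite subr_gt0.
have B0 : 0 <= B1 by rewrite addr_ge0 ?sqr_ge0.
have h' s : 0 <= s -> s <= 1 -> 0 <= s * (s * B1 - 2 * A1).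
  move=> s0 s1; have := h s s0 s1; rewrite -subr_ge0.
  suff -> : q (m + s *: (d - m)) - q m = s * (s * B1 - 2 * A1) by [].
  by rewrite /A1 /B1 /q !mxE; ring.
have AB0 : 0 < A1 + B1 by lra.
(* Moving by this fraction towards [x'] and [y'] would shorten the closest segment. *)
have := h' (A1 / (A1 + B1)).
have s0 : 0 < A1 / (A1 + B1) by rewrite divr_gt0.
have s1 : A1 / (A1 + B1) <= 1 by rewrite ler_pdivrMr // mul1r lerDl.
move=> /(_ (ltW s0) s1); rewrite pmulr_rge0 //.
have : A1 / (A1 + B1) * B1 <= A1.
  by rewrite mulrAC ler_pdivrMr // ler_pM2l // lerDr ltW.
by lra.
Qed.

Lemma superset_card (n m : nat) (A : {set 'I_n}) : (#|A| <= m)%N -> (m <= n)%N ->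
  exists2 B : {set 'I_n}, A \subset B & #|B| = m.
Proof.
elim: m => [|m IH] Am mn.
  by exists A => //; apply/eqP; rewrite -leqn0.
move: Am; rewrite leq_eqVlt => /orP[/eqP Am|Am]; first by exists A.
have [B AB Bm] := IH Am (ltnW mn).
have : (0 < #|~: B|)%N.
  by have := cardsC B; rewrite Bm card_ord; lia.
case/card_gt0P => x; rewrite !inE => xB.
exists (x |: B); last by rewrite cardsU1 xB Bm.
by rewrite (fintype.subset_trans AB) // finset.subsetUr.
Qed.

End SideConditions.

(** * The ordered transversal theorem for closed side conditions *)

Section OrderedTransversal.
Context {R : realType} (n : nat) (hn : (4 <= n)%N).
Context (C : 'I_n -> set 'rV[R]_2) (Ok : 'I_n -> 'rV[R]_2 -> R -> Prop).
Context (C_disjoint : forall i j : 'I_n, i != j -> C i `&` C j = set0)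
  (C_compact : forall i, compact (C i)) (C_convex : forall i, convex_set (C i))
  (C_meets : forall i, side_meets (C i) (Ok i))
  (C_rotates : forall i, side_rotates (C i) (Ok i)).
Context (four : forall A : {set 'I_n}, #|A| = 4 -> exists (u : 'rV[R]_2) c,
  [/\ u != 0, forall i, i \in A -> stab (Ok i) u c &
      forall i j, i \in A -> j \in A -> (i < j)%N -> dir_cone (C i) (C j) u]).
Implicit Types (u v w x y z : 'rV[R]_2) (c e s t : R) (i j k p q : 'I_n).

Lemma ltn_ord_neq i j : (i < j)%N -> i != j.
Proof. by move=> ij; apply/eqP => e; rewrite e ltnn in ij. Qed.

Lemma cones_pointed i j : (i < j)%N -> pointed_cone (dir_cone (C i) (C j)).
Proof.
by move=> ij; apply: dir_cone_pointed => //; apply/C_disjoint/ltn_ord_neq.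
Qed.

Lemma two_pairs p q i j : (p < q)%N -> (i < j)%N -> exists u c,
  [/\ u != 0, forall k, k \in [:: p; q; i; j] -> stab (Ok k) u c,
      dir_cone (C p) (C q) u & dir_cone (C i) (C j) u].
Proof.
move=> pq ij.
have [||A /fintype.subsetP sA A4] := @superset_card n 4 [set k in [:: p; q; i; j]]%SET.
- by rewrite cardsE (leq_trans (card_size _)).
- exact: hn.
have inA k : k \in [:: p; q; i; j] -> k \in A by move=> kA; apply: sA; rewrite inE.
have [u [c [u0 st ord]]] := four A4.
exists u, c; split => //.
- by move=> k /inA; exact: st.
- by apply: ord => //; apply: inA; rewrite !inE eqxx ?orbT.
- by apply: ord => //; apply: inA; rewrite !inE eqxx ?orbT.
Qed.

Lemma member_nonempty i : C i !=set0.
Proof.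
have [||A /fintype.subsetP sA A4] := @superset_card n 4 [set k in [:: i]]%SET.
- by rewrite cardsE (leq_trans (card_size _)).
- exact: hn.
have [u [c [u0 st _]]] := four A4.
have [|x Cx _] := stab_meets (@C_convex i) (@C_meets i) (st i _).
  by apply: sA; rewrite !inE.
by exists x.
Qed.

(** A common stabber is recorded by a point in each set, with [y - x] as direction, so that these
    stabbers range over a subset of a compact product. *)
Definition pair_stab p q x y := [/\ C p x, C q y,
  stab (Ok p) (y - x) (cross (y - x) x) &
  stab (Ok q) (y - x) (cross (y - x) x)].

Lemma pair_stabC p q x y : pair_stab p q x y -> pair_stab q p y x.
Proof.
case=> Cx Cy s1 s2.
have e : cross (x - y) y = - cross (y - x) x by rewrite !crossE; rewrite (crossC y x); ring.
by split => //; rewrite e -opprB; exact: stabN.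
Qed.

Lemma line_pair_stab p q u c x y : p != q -> u != 0 -> stab (Ok p) u c ->
  stab (Ok q) u c -> C p x -> C q y -> cross u x = c -> cross u y = c ->
  pair_stab p q x y.
Proof.
move=> pq u0 sp sq Cx Cy xc yc.
have v0 := disjoint_neq (C_disjoint pq) Cx Cy.
have vu : cross (y - x) u = 0 by rewrite crossC !crossE xc yc subrr oppr0.
split=> //.
  exact: (stab_parallel (@C_rotates p) u0 v0 vu Cx xc sp).
have -> : cross (y - x) x = cross (y - x) y.
  by rewrite !crossE (crossC y x); ring.
exact: (stab_parallel (@C_rotates q) u0 v0 vu Cy yc sq).
Qed.

Lemma ordered_pair_stab p q u c : (p < q)%N -> u != 0 -> stab (Ok p) u c ->
  stab (Ok q) u c -> dir_cone (C p) (C q) u ->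
  exists x y (k : R), [/\ pair_stab p q x y, 0 < k & y - x = k *: u].
Proof.
move=> pq u0 sp sq Du.
have [x Cx xc] := stab_meets (@C_convex p) (@C_meets p) sp.
have [y Cy yc] := stab_meets (@C_convex q) (@C_meets q) sq.
have [|k k0 kE] := dir_cone_stab (cones_pointed pq) Du Cx Cy.
  by rewrite xc yc.
exists x, y, k; split => //.
exact: (line_pair_stab (ltn_ord_neq pq) u0 sp sq).
Qed.

Lemma cross_inj u v x y : cross u v != 0 -> cross u x = cross u y ->
  cross v x = cross v y -> x = y.
Proof.
move=> uv ux vx.
have v0 : v != 0 by apply: contra uv => /eqP ->; rewrite cross0r.
have [|k kE] := @cross_eq0P _ v (x - y) v0; first by rewrite !crossE vx subrr.
have : cross u (x - y) = 0 by rewrite !crossE ux subrr.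
rewrite kE crossZr => /eqP; rewrite mulf_eq0 (negbTE uv) orbF => /eqP k0.
by apply/eqP; rewrite -subr_eq0 kE k0 scale0r.
Qed.

(* If [p] lies too far left and [q] too far right of a line directed by [u],
   then every common stabber running from [p] to [q] turns right of [u]. *)
Lemma pair_stab_cross_lt0 p q u c x y : p != q -> u != 0 -> ~ Ok p u c ->
  ~ Ok q (- u) (- c) -> pair_stab p q x y -> cross u (y - x) < 0.
Proof.
move=> pq u0 nOkp nOkq [Cx Cy sp sq].
have v0 := disjoint_neq (C_disjoint pq) Cx Cy.
have Cpq z : C p z -> C q z -> False.
  move=> zp zq; have : (C p `&` C q) z by [].
  by rewrite C_disjoint.
rewrite ltNge; apply/negP; move: v0 sp sq.
have [v vE] : exists v, v = y - x by eexists.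
rewrite -vE => v0 sp sq uv.
have yE : y = x + v by rewrite vE addrC subrK.
have vy : cross v y = cross v x by rewrite yE crossDr crossvv addr0.
have uy : cross u y = cross u x + cross u v by rewrite yE crossDr.
(* If [x] is not left of the line [(u, c)], turning the stabber about [x] would give [Ok p u c],
   unless the lines cross at a point [z] of [C p]. The case of [q] is symmetric. *)
have P : cross u x <= c -> exists z, [/\ C p z, cross u z = c,
    cross v z = cross v x & cross u v != 0].
  move=> xc; apply: contrapT => nex; apply: nOkp.
  apply: (C_rotates u0 v0 sp Cx) => // uv0 z Cz zc vz.
  by apply: nex; exists z.
have Q : c <= cross u y -> exists z, [/\ C q z, cross u z = c,
    cross v z = cross v x & cross u v != 0].
  move=> cy; apply: contrapT => nex; apply: nOkq.
  apply: (C_rotates _ v0 sq Cy vy); rewrite ?oppr_eq0 ?crossNl ?lerN2 //.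
  rewrite oppr_eq0 => uv0 z Cz; rewrite crossNl => /oppr_inj zc vz.
  by apply: nex; exists z.
have [xc|xc] := lerP (cross u x) c.
  have [z [Cz zc vz uv0]] := P xc.
  have uvp : 0 < cross u v by rewrite lt_neqAle eq_sym uv0.
  (* Either the crossing point belongs to both sets, or [y] lies between [x] and [z], hence in
     [C p]; both contradict disjointness. *)
  have [cy|cy] := lerP c (cross u y).
    have [z' [Cz' zc' vz' _]] := Q cy.
    have e : z = z' by apply: (cross_inj uv0); [rewrite zc zc'|rewrite vz vz'].
    by apply: (Cpq z) => //; rewrite e.
  have [|k kE] := @cross_eq0P _ v (z - x) v0; first by rewrite !crossE vz subrr.
  have k1 : 1 < k.
    have : cross u (z - x) = k * cross u v by rewrite kE crossZr.
    rewrite crossDr crossNr zc => e; rewrite -(ltr_pM2r uvp); lra.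
  apply: (Cpq y) => //.
  have -> : y = k^-1 *: z + (1 - k^-1) *: x.
    have kn0 : k != 0 by rewrite gt_eqF // (lt_trans ltr01).
    have -> : z = x + k *: v by rewrite -kE addrC subrK.
    by rewrite yE; apply: rV2_eq; rewrite !mxE; field.
  have /convex_setP := @C_convex p; apply => //.
    by rewrite invr_ge0; lra.
  by rewrite invf_le1; lra.
(* Now [x] lies between [z] and [y], hence in [C q]. *)
have cy : c <= cross u y by lra.
have [z [Cz zc vz uv0]] := Q cy.
have uvp : 0 < cross u v by rewrite lt_neqAle eq_sym uv0.
have [|k kE] := @cross_eq0P _ v (y - z) v0; first by rewrite !crossE vz vy subrr.
have k1 : 1 < k.
  have : cross u (y - z) = k * cross u v by rewrite kE crossZr.
  rewrite crossDr crossNr zc => e; rewrite -(ltr_pM2r uvp); lra.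
apply: (Cpq x) => //.
have -> : x = k^-1 *: z + (1 - k^-1) *: y.
  have kn0 : k != 0 by rewrite gt_eqF // (lt_trans ltr01).
  have -> : z = y - k *: v by rewrite -kE opprB addrC subrK.
  by rewrite yE; apply: rV2_eq; rewrite !mxE; field.
have /convex_setP := @C_convex q; apply => //.
  by rewrite invr_ge0; lra.
by rewrite invf_le1; lra.
Qed.

Lemma two_pair_stabs p q i j : (p < q)%N -> (i < j)%N ->
  exists x y x' y' (k : R), [/\ pair_stab p q x y, pair_stab i j x' y', 0 < k
    & y' - x' = k *: (y - x)].
Proof.
move=> pq ij; have [v [c [v0 st Dp Di]]] := two_pairs pq ij.
have sp : stab (Ok p) v c by apply: st; rewrite !inE eqxx ?orbT.
have sq : stab (Ok q) v c by apply: st; rewrite !inE eqxx ?orbT.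
have si : stab (Ok i) v c by apply: st; rewrite !inE eqxx ?orbT.
have sj : stab (Ok j) v c by apply: st; rewrite !inE eqxx ?orbT.
have [x [y [k [ps k0 kE]]]] := ordered_pair_stab pq v0 sp sq Dp.
have [x' [y' [k' [ps' k0' kE']]]] := ordered_pair_stab ij v0 si sj Di.
exists x, y, x', y', (k' / k); split => //; first exact: divr_gt0.
by rewrite kE kE' scalerA divfK // gt_eqF.
Qed.

(** * The three alternatives for a direction *)

Definition beyond u := exists p q, (p < q)%N /\
  forall x y, pair_stab p q x y -> cross u (y - x) < 0.

Definition straddled i u := (forall c, ~ stab (Ok i) u c) /\
  forall k, k != i -> exists x y x' y', [/\ pair_stab i k x y,
    0 < cross u (y - x), pair_stab i k x' y' & cross u (y' - x') < 0].

(** The four-set hypothesis gives any two pairs parallel stabbers, which cannot turn both strictly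
    right and strictly left of [u]. *)
Lemma beyondN u : beyond u -> ~ beyond (- u).
Proof.
move=> [p [q [pq uP]]] [i [j [ij vP]]].
have [x [y [x' [y' [k [ps ps' k0 kE]]]]]] := two_pair_stabs pq ij.
move: (uP _ _ ps) (vP _ _ ps'); rewrite kE crossNl !crossZr.
by rewrite oppr_lt0 pmulr_rgt0 //; lra.
Qed.

Lemma straddledN i u : straddled i u -> straddled i (- u).
Proof.
move=> [ns st]; split=> [c sc|k /st[x [y [x' [y' [h1 h2 h3 h4]]]]]].
  by move: (stabN sc); rewrite opprK; exact: ns.
exists x', y', x, y; split=> //; rewrite crossNl; lra.
Qed.

Context (C_closed : forall i, side_closed (C i) (Ok i)).

(** A Dedekind cut: the infimum of the levels with enough on the right for every member serves for
    both sides, by closedness. The exceptional level [c0] makes it possible to find two distinct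
    gaps later. *)
Lemma directional_cut (S : pred 'I_n) u c0 : u != 0 -> (exists i, S i) ->
  (forall c, c != c0 ->
    (forall i, S i -> Ok i u c) \/ (forall i, S i -> Ok i (- u) (- c))) ->
  exists c, forall i, S i -> stab (Ok i) u c.
Proof.
move=> u0 [i0 Si0] cut.
have [M MP] := compact_cross_bounded u (@C_compact i0).
pose A := [set c | forall i, S i -> Ok i u c].
have infA : has_inf A.
  split.
    pose c1 := if M + 1 == c0 then M + 2 else M + 1.
    have c1M : M < c1 by rewrite /c1; case: ifP; lra.
    have c10 : c1 != c0.
      rewrite /c1; case: ifP => [/eqP <-|->//]; apply/eqP; lra.
    exists c1 => i Si; have [h|/(_ _ Si0)/C_meets[x /MP]] := cut c1 c10.
      exact: h.
    by rewrite crossNl lerN2 ler_norml => /andP[]; lra.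
  exists (- M) => c /(_ _ Si0)/C_meets[x /MP].
  by rewrite ler_norml => /andP[]; lra.
exists (inf A) => i Si.
apply: (side_closed_stab (@C_closed i) u0) => e e0.
  have [a Aa ae] := inf_adherent e0 infA.
  exists u, a; split; first exact: Aa.
  move=> x _; have : inf A <= a by apply: (ge_inf infA.2).
  by move=> ?; rewrite ler_norml; apply/andP; split; lra.
(* Just below the infimum, and stepping over [c0], the first alternative of [cut] fails, so the
   second one holds. *)
pose c := if inf A - e == c0 then inf A - e / 2 else inf A - e.
have cc0 : c != c0.
  rewrite /c; case: ifP => [/eqP <-|->//]; apply/eqP; lra.
have [cl cg] : inf A - e <= c /\ c < inf A.
  by rewrite /c; case: ifP => _; split; lra.
exists (- u), (- c); split.
  have [h|] := cut c cc0; last by apply.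
  have : inf A <= c by apply: (ge_inf infA.2).
  by lra.
by move=> x _; rewrite ler_norml; apply/andP; split; lra.
Qed.

(** By [directional_cut] there is a level at which some [p] lacks enough on the right and some [q]
    on the left. The order of [p] and [q] decides the alternative, [p = q] giving the third unless
    one of the first two holds. *)
Lemma direction_trichotomy u : u != 0 -> ~ (exists c, forall i, stab (Ok i) u c) ->
  [\/ beyond u, beyond (- u) | exists i, straddled i u].
Proof.
move=> u0 ngood.
have [p [q [c [nOkp nOkq]]]] : exists p q c, ~ Ok p u c /\ ~ Ok q (- u) (- c).
  apply: contrapT => nex; apply: ngood.
  have [||c cP] := @directional_cut xpredT u 0 u0.
  - by exists (Ordinal (leq_trans (isT : (0 < 4)%N) hn)).
  - move=> c _; apply: contrapT => /not_orP[/existsNP[p /not_implyP[_ np]]].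
    by move=> /existsNP[q /not_implyP[_ nq]]; apply: nex; exists p, q, c.
  by exists c => i; exact: cP.
case: (ltngtP p q) => [pq|qp|/val_inj e].
- apply: Or31; exists p, q; split=> // x y.
  exact: (pair_stab_cross_lt0 (ltn_ord_neq pq) u0 nOkp nOkq).
- apply: Or32; exists q, p; split=> // x y.
  apply: (pair_stab_cross_lt0 (ltn_ord_neq qp) (c := - c)) => //.
    by rewrite oppr_eq0.
  by rewrite !opprK.
rewrite -{q}e in nOkq.
have [?|nb] := pselect (beyond u); first exact: Or31.
have [?|nbN] := pselect (beyond (- u)); first exact: Or32.
move: p nOkp nOkq => i nOkp nOkq.
apply: Or33; exists i.
(* Translating a stabber directed by [u] to the level [c] would keep enough on one of the sides. *)
have ns c' : ~ stab (Ok i) u c'.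
  move=> s; have [x Cx xc] := stab_meets (@C_convex i) (@C_meets i) s.
  have [le|/ltW le] := lerP c' c.
    by apply: nOkp; apply: (C_rotates u0 u0 s Cx) => //; rewrite ?xc // crossvv eqxx.
  apply: nOkq; apply: (C_rotates _ u0 s Cx) => //; rewrite ?oppr_eq0 //.
    by rewrite crossNl xc lerN2.
  by rewrite crossNl crossvv oppr0 eqxx.
split=> // k ki.
have nz a b : pair_stab i k a b -> cross u (b - a) <> 0.
  move=> [Ca Cb sa _] e; apply: (ns (cross u a)).
  apply: (stab_parallel (@C_rotates i) _ u0 e Ca _ sa) => //.
  by apply: (disjoint_neq (C_disjoint _) Ca Cb); rewrite eq_sym.
have [[a [b [ab1 ab2]]] [a' [b' [ab1' ab2']]]] :
    (exists a b, pair_stab i k a b /\ 0 <= cross u (b - a)) /\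
    (exists a b, pair_stab i k a b /\ cross u (b - a) <= 0).
  (* The order of [i] and [k] fixes which turn [aux] yields; applied to [u] and [- u] it yields
     both. *)
  have aux v : ~ beyond v ->
      if (i < k)%N then exists a b, pair_stab i k a b /\ 0 <= cross v (b - a)
      else exists a b, pair_stab i k a b /\ cross v (b - a) <= 0.
    move=> nbv; case: ltnP => ik; apply: contrapT => nex; apply: nbv.
      exists i, k; split => // x y ps; rewrite ltNge; apply/negP => h.
      by apply: nex; exists x, y.
    have ki' : (k < i)%N by rewrite ltn_neqAle ik andbT.
    exists k, i; split => // x y /pair_stabC ps; rewrite ltNge; apply/negP => h.
    apply: nex; exists y, x; split => //.
    by rewrite -opprB crossNr oppr_le0.
  move: (aux _ nb) (aux _ nbN); case: ifP => _ h1 [a [b [ab1 ab2]]]; split=> //;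
    by exists a, b; split=> //; move: ab2; rewrite crossNl; lra.
exists a, b, a', b'; split => //; rewrite lt_neqAle.
  by rewrite ab2 andbT eq_sym; apply/eqP/nz.
by rewrite ab2' andbT; apply/eqP/nz.
Qed.

Definition gap i u c := ~ Ok i u c /\ ~ Ok i (- u) (- c).

(** Otherwise [directional_cut] for [i] alone would produce a stabber directed by [u]. *)
Lemma straddled_gap i u c0 : u != 0 -> straddled i u ->
  exists2 c, c != c0 & gap i u c.
Proof.
move=> u0 [ns _]; apply: contrapT => nex.
have [||c cP] := @directional_cut (pred1 i) u c0 u0; last 1 first.
- by apply: (ns c); apply: cP; rewrite /= eqxx.
- by exists i; rewrite /= eqxx.
move=> c cc0; apply: contrapT => /not_orP[/existsNP[p /not_implyP[/eqP -> np]]].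
by move=> /existsNP[q /not_implyP[/eqP -> nq]]; apply: nex; exists c.
Qed.

(** At a gap, [i] can play either part in [pair_stab_cross_lt0]: a failure of [k] would force all
    common stabbers of [i] and [k] to turn the same way. *)
Lemma straddled_stab i u c k : u != 0 -> straddled i u -> gap i u c ->
  k != i -> stab (Ok k) u c.
Proof.
move=> u0 [_ st] [n1 n2] ki; have [x [y [x' [y' [p1 l1 p2 l2]]]]] := st k ki.
have ik : i != k by rewrite eq_sym.
split; apply: contrapT => nk.
  have := @pair_stab_cross_lt0 i k (- u) (- c) x' y' ik _ n2 _ p2.
  by rewrite oppr_eq0 !opprK crossNl => /(_ u0 nk); lra.
by have := pair_stab_cross_lt0 ik u0 n1 nk p1; lra.
Qed.

(** A pair containing [i] has stabbers on both sides of [u]; a pair avoiding [i] has a common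
    stabber directed by [u], at a gap of [i]. *)
Lemma straddled_not_beyond i u : u != 0 -> straddled i u -> ~ beyond u.
Proof.
move=> u0 st [p [q [pq uP]]].
have [pi|pi] := eqVneq p i.
  have [|x [y [x' [y' [p1 l1 p2 l2]]]]] := st.2 q.
    by rewrite -pi eq_sym ltn_ord_neq.
  by rewrite pi in uP; have := uP _ _ p1; lra.
have [qi|qi] := eqVneq q i.
  have [x [y [x' [y' [p1 l1 /pair_stabC p2 l2]]]]] := st.2 p pi.
  rewrite qi in uP; have := uP _ _ p2; rewrite -opprB crossNr; lra.
have [c _ gc] := straddled_gap 0 u0 st.
have sp := straddled_stab u0 st gc pi; have sq := straddled_stab u0 st gc qi.
have [x Cx xc] := stab_meets (@C_convex p) (@C_meets p) sp.
have [y Cy yc] := stab_meets (@C_convex q) (@C_meets q) sq.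
have := uP _ _ (line_pair_stab (ltn_ord_neq pq) u0 sp sq Cx Cy xc yc).
by rewrite !crossE xc yc subrr ltxx.
Qed.

(** The arc of some pair lies weakly to the left of [u], as at an end of the intersection of all
    arcs. *)
Definition extreme u := exists p q, (p < q)%N /\
  forall x y, C p x -> C q y -> 0 <= cross u (y - x).

Lemma extreme_not_beyond u : extreme u -> ~ beyond u.
Proof.
move=> [i [j [ij vP]]] [p [q [pq uP]]].
have [x [y [x' [y' [k [ps [Cx Cy _ _] k0 kE]]]]]] := two_pair_stabs pq ij.
move: (uP _ _ ps) (vP _ _ Cx Cy); rewrite kE crossZr.
by rewrite pmulr_rge0 //; lra.
Qed.

(** For gaps [c < c'] of [i], the line at [c'] stabs [C p] and the one at [c] stabs [C q], so some
    step from [C p] to [C q] turns right of [u]. If [i] is in the pair, its stabbers on both sides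
    of [u] give such a step. *)
Lemma extreme_not_straddled i u : u != 0 -> extreme u -> ~ straddled i u.
Proof.
move=> u0 [p [q [pq uP]]] st.
have [pi|pi] := eqVneq p i.
  have [|x [y [x' [y' [p1 l1 [Cx Cy _ _] l2]]]]] := st.2 q.
    by rewrite -pi eq_sym ltn_ord_neq.
  by rewrite pi in uP; have := uP _ _ Cx Cy; lra.
have [qi|qi] := eqVneq q i.
  have [x [y [x' [y' [[Cy Cx _ _] l1 _ _]]]]] := st.2 p pi.
  rewrite qi in uP; have := uP _ _ Cx Cy; rewrite -opprB crossNr; lra.
have [c _ gc] := straddled_gap 0 u0 st.
have [c' cc' gc'] := straddled_gap c u0 st.
wlog lcc : c c' gc gc' cc' / c < c'.
  move=> H; have [lt|le] := ltrP c c'; first exact: (H c c').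
  by apply: (H c' c) => //; [rewrite eq_sym|rewrite lt_neqAle cc'].
have sp := straddled_stab u0 st gc' pi; have sq := straddled_stab u0 st gc qi.
have [x Cx xc] := stab_meets (@C_convex p) (@C_meets p) sp.
have [y Cy yc] := stab_meets (@C_convex q) (@C_meets q) sq.
have := uP _ _ Cx Cy; rewrite !crossE xc yc; lra.
Qed.

(** Over the compact product of the two sets, the strict inequality persists near a common stabber,
    and closedness keeps common stabbers away from any other pair of points. *)
Lemma near_beyond (U : R -> 'rV[R]_2) t0 : U t @[t --> t0] --> U t0 ->
  beyond (U t0) -> \forall t \near t0, beyond (U t).
Proof.
move=> Ut [p [q [pq uP]]].
suff : \forall t \near t0, forall z : 'rV[R]_2 * 'rV[R]_2, (C p `*` C q) z ->
    pair_stab p q z.1 z.2 -> cross (U t) (z.2 - z.1) < 0.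
  apply: filterS => t sub; exists p, q; split => // x y ps.
  by case: (ps) => Cx Cy _ _; apply: (sub (x, y)).
apply: compact_near; first exact: compact_setX.
move=> -[x y] [/= Cx Cy].
have v0 := disjoint_neq (C_disjoint (ltn_ord_neq pq)) Cx Cy.
pose f (z : 'rV[R]_2 * 'rV[R]_2) : 'rV[R]_2 := z.2 - z.1.
have fz : f @ (x, y) --> f (x, y) by apply: cvgB; [exact: cvg_snd|exact: cvg_fst].
have fx : z.1 @[z --> (x, y)] --> x by exact: cvg_fst.
have [ps|nps] := pselect (pair_stab p q x y).
  have := uP _ _ ps => lt0.
  have UF : U z.2 @[z --> ((x, y), t0)] --> U t0.
    by apply: (cvg_comp snd U) Ut; exact: cvg_snd.
  have fF : f z.1 @[z --> ((x, y), t0)] --> f (x, y).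
    by apply: (cvg_comp fst f) fz; exact: cvg_fst.
  have H : \forall z \near ((x, y), t0), cross (U z.2) (f z.1) < 0.
    exact: (near_cross_lt UF fF lt0).
  by apply: filterS H => z ? _.
have : \forall z \near (x, y), ~ pair_stab p q z.1 z.2.
  have nn r : ~ stab (Ok r) (y - x) (cross (y - x) x) ->
      \forall z \near (x, y), ~ stab (Ok r) (f z) (cross (f z) z.1).
    move=> ns; apply: (near_not_stab (C := C r)) => //.
    exact: (cvg_cross fz fx).
  have [sp|/nn] := pselect (stab (Ok p) (y - x) (cross (y - x) x)); last first.
    by apply: filterS => z + [].
  have [sq|/nn] := pselect (stab (Ok q) (y - x) (cross (y - x) x)); last first.
    by apply: filterS => z + [].
  by case: nps; split.
move=> H.
have H' : \forall z \near ((x, y), t0), ~ pair_stab p q z.1.1 z.1.2.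
  exact: (cvg_fst H).
by apply: filterS H' => z nz ps; case: (nz ps).
Qed.

(** Every stabber of [C i] passes through a point of [C i], so compactness makes their absence open;
    the finitely many strict inequalities are open as well. *)
Lemma near_straddled (U : R -> 'rV[R]_2) i t0 : U t0 != 0 ->
  U t @[t --> t0] --> U t0 ->
  straddled i (U t0) -> \forall t \near t0, straddled i (U t).
Proof.
move=> U0 Ut [ns st].
have n1 : \forall t \near t0, forall x, C i x ->
    ~ stab (Ok i) (U t) (cross (U t) x).
  apply: compact_near => // x Cx.
  have UF : U z.2 @[z --> (x, t0)] --> U t0.
    by apply: (cvg_comp snd U) Ut; exact: cvg_snd.
  have xF : z.1 @[z --> (x, t0)] --> x by exact: cvg_fst.
  pose V (z : 'rV[R]_2 * R) := U z.2.
  have : \forall z \near (x, t0), ~ stab (Ok i) (V z) (cross (V z) z.1).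
    apply: (near_not_stab (C := C i)) => //.
    exact: (cvg_cross UF xF).
  by [].
pose Q k t := k != i -> exists x y x' y',
    [/\ pair_stab i k x y, 0 < cross (U t) (y - x), pair_stab i k x' y'
      & cross (U t) (y' - x') < 0].
have n2 : \forall t \near t0, forall k, Q k t.
  apply: (@filter_forall R 'I_n Q (nbhs t0)) => k; rewrite /Q.
  have [->|ki] := eqVneq k i; first by apply: nearW => t /eqP.
  have [x [y [x' [y' [p1 l1 p2 l2]]]]] := st k ki.
  have h1 : \forall t \near t0, 0 < cross (U t) (y - x).
    exact: (near_cross_gt Ut (cvg_cst (y - x)) l1).
  have h2 : \forall t \near t0, cross (U t) (y' - x') < 0.
    exact: (near_cross_lt Ut (cvg_cst (y' - x')) l2).
  near=> t => _; exists x, y, x', y'; split => //; near: t; [exact: h1|exact: h2].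
near=> t; split; last by near: t; exact: n2.
move=> c s; have [x Cx xc] := stab_meets (@C_convex i) (@C_meets i) s.
move: s; rewrite -xc; move: x Cx {xc}; near: t; exact: n1.
Unshelve. all: by end_near. Qed.

(** Separating two of the sets by [h] puts all common directions [u] in the half-plane
    [0 < cross h u]. Scaled to [cross h u = 1], they form a compact interval of parameters [t], at
    whose ends some arc ends too. *)
Lemma ordered_arc : exists w h t0 t1, [/\ t0 <= t1,
  forall t, w - t *: h != 0,
  extreme (w - t0 *: h), extreme (- (w - t1 *: h)) &
  forall t, t0 <= t <= t1 -> forall i j, (i < j)%N ->
    dir_cone (C i) (C j) (w - t *: h)].
Proof.
pose i0 : 'I_n := Ordinal (leq_trans (isT : (0 < 4)%N) hn).
pose i1 : 'I_n := Ordinal (leq_trans (isT : (1 < 4)%N) hn).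
have i01 : (i0 < i1)%N by [].
have [h [d [h0 d0 hd]]] := compact_convex_separation (@C_compact i0)
  (@C_compact i1) (@C_convex i0) (@C_convex i1)
  (C_disjoint (ltn_ord_neq i01)) (member_nonempty i0) (member_nonempty i1).
have [w w0 hw] := cross_neq0P h0.
pose U t := w - t *: h.
have hU t : cross h (U t) = 1 by rewrite !crossE hw; ring.
have UU t s : cross (U t) (U s) = s - t.
  by rewrite !crossE (crossC w h) hw; ring.
have U0 t : U t != 0.
  by apply/eqP => e; move/eqP: (hU t); rewrite e cross0r eq_sym oner_eq0.
have Ucvg t : U s @[s --> t] --> U t.
  apply: cvgB; first exact: cvg_cst.
  by apply: cvgZl; exact: cvg_id.
pose K := [set t | forall i j, (i < j)%N -> dir_cone (C i) (C j) (U t)].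
have [k0 Kk0] : K !=set0.
  have D4 (A : {set 'I_n}) : #|A| = 4 -> exists u, forall i j,
      i \in A -> j \in A -> (i < j)%N -> dir_cone (C i) (C j) u.
    by move=> /four[u [c [_ _ uP]]]; exists u.
  have n4 : (4 <= #|[set: 'I_n]%SET|)%N by rewrite cardsT card_ord.
  have [u uP] := cone_helly cones_pointed D4 n4.
  have [x [y [k [Cx Cy k0 uE]]]] := uP i0 i1 (finset.in_setT _) (finset.in_setT _) i01.
  have hu : 0 < cross h u.
    by rewrite uE crossZr mulr_gt0 // (lt_le_trans d0) // hd.
  exists (- cross u w / cross h u) => i j ij.
  have -> : U (- cross u w / cross h u) = (cross h u)^-1 *: u.
    have hw0 : cross h u != 0 by rewrite gt_eqF.
    have e' : cross h u *: w + cross u w *: h = u.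
      have /eqP := cross_triple h u w; rewrite (crossC w h) hw scaleN1r addrAC.
      by rewrite subr_eq0 addrC => /eqP.
    have -> : (cross h u)^-1 *: u =
        (cross h u)^-1 *: (cross h u *: w + cross u w *: h) by rewrite e'.
    rewrite scalerDr !scalerA mulVf // scale1r /U; congr (_ + _).
    by rewrite -scaleNr mulNr opprK mulrC.
  apply: pointed_coneZ; rewrite ?invr_gt0 //; first exact: cones_pointed.
  by apply: uP; rewrite ?inE.
have nearK t : ~ K t -> \forall s \near t, ~ K s.
  move=> nK.
  have [i [j [ij nD]]] : exists i j, (i < j)%N /\ ~ dir_cone (C i) (C j) (U t).
    apply: contrapT => nex; apply: nK => i j ij; apply: contrapT => nD.
    by apply: nex; exists i, j.
  (* A missing direction stays missing: near each pair of points either the step is not parallel to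
     [U s], or it can only be directed against it. *)
  suff : \forall s \near t, forall z : 'rV[R]_2 * 'rV[R]_2, (C i `*` C j) z ->
      cross (U s) (z.2 - z.1) != 0 \/ cross h (z.2 - z.1) < 0.
    apply: filterS => s sP /(_ i j ij)[x [y [k [Cx Cy k0' sE]]]].
    have [] := sP (x, y); first by [].
      by rewrite /= sE crossZl crossvv mulr0 eqxx.
    have := hU s; rewrite sE crossZr /= => e1 lt.
    by have := pmulr_rlt0 (cross h (y - x)) k0'; rewrite e1 lt ltNge ler01.
  apply: compact_near; first exact: compact_setX.
  move=> -[x y] [/= Cx Cy].
  pose f (z : 'rV[R]_2 * 'rV[R]_2) : 'rV[R]_2 := z.2 - z.1.
  have fz : f @ (x, y) --> f (x, y) by apply: cvgB; [exact: cvg_snd|exact: cvg_fst].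
  have UF : U z.2 @[z --> ((x, y), t)] --> U t.
    by apply: (cvg_comp snd U) (Ucvg t); exact: cvg_snd.
  have fF : f z.1 @[z --> ((x, y), t)] --> f (x, y).
    by apply: (cvg_comp fst f) fz; exact: cvg_fst.
  case: (ltrgtP (cross (U t) (y - x)) 0) => [lt|gt|e].
  - have H : \forall z \near ((x, y), t), cross (U z.2) (f z.1) < 0.
      exact: (near_cross_lt UF fF lt).
    by apply: filterS H => z ?; left; rewrite lt_eqF.
  - have H : \forall z \near ((x, y), t), 0 < cross (U z.2) (f z.1).
      exact: (near_cross_gt UF fF gt).
    by apply: filterS H => z ?; left; rewrite gt_eqF.
  have [k kE] := cross_eq0P (U0 t) e.
  have kn0 : k != 0.
    apply/eqP => k0'; have := disjoint_neq (C_disjoint (ltn_ord_neq ij)) Cx Cy.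
    by rewrite kE k0' scale0r eqxx.
  have klt : cross h (y - x) < 0.
    rewrite kE crossZr hU mulr1 lt_neqAle kn0 leNgt; apply/negP => kp.
    apply: nD; exists x, y, k^-1; split; rewrite ?invr_gt0 //.
    by rewrite kE scalerA mulVf // scale1r.
  have H : \forall z \near ((x, y), t), cross h (f z.1) < 0.
    exact: (near_cross_lt (cvg_cst h) fF klt).
  by apply: filterS H => z ?; right.
have [M MP] : exists M, forall x y, C i0 x -> C i1 y -> `|cross w (y - x)| <= M.
  have [M1 M1P] := compact_cross_bounded w (@C_compact i0).
  have [M2 M2P] := compact_cross_bounded w (@C_compact i1).
  exists (M2 + M1) => x y /M1P l1 /M2P l2; rewrite crossDr crossNr.
  by rewrite (le_trans (ler_normB _ _)) // lerD.
have Kbound t : K t -> `|t| <= M / d.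
  move=> /(_ _ _ i01)[x [y [k [Cx Cy k0' tE]]]].
  have := congr1 (fun v => cross v (y - x)) tE.
  rewrite crossZl crossvv mulr0 crossDl crossNl crossZl => /eqP.
  rewrite subr_eq0 => /eqP e; have := MP x y Cx Cy; rewrite e normrM.
  have := hd x y Cx Cy => le1 le2; rewrite ler_pdivlMr //.
  by apply: le_trans le2; apply: ler_wpM2l => //; apply: le_trans le1 _; exact: ler_norm.
have [infK supK] : has_inf K /\ has_sup K.
  split; split; try by exists k0.
    exists (- (M / d)) => t /Kbound; rewrite ler_norml => /andP[]; lra.
  exists (M / d) => t /Kbound; rewrite ler_norml => /andP[]; lra.
have closeK t : (forall e, 0 < e -> exists2 s, K s & `|t - s| < e) -> K t.
  move=> tK; apply: contrapT => /nearK /nbhs_ballP[e /= e0 sub].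
  by have [s Ks ts] := tK e e0; apply: (sub s).
have Kinf : K (inf K).
  apply: closeK => e e0; have [s Ks se] := inf_adherent e0 infK.
  exists s => //; have := ge_inf infK.2 Ks => le.
  by rewrite distrC ger0_norm ?subr_ge0 // ltrBlDl.
have Ksup : K (sup K).
  apply: closeK => e e0; have [s Ks se] := sup_adherent e0 supK.
  exists s => //; have := ub_le_sup supK.2 Ks => le.
  by rewrite ger0_norm ?subr_ge0 // ltrBlDr addrC -ltrBlDr.
(* The sign [sg] treats both ends at once. If no pair were extreme at [t], every arc would contain a
   direction strictly beyond [U t], hence also [U s] for [s] slightly beyond [t], and [K] would not
   end there. *)
have ext (sg t : R) : (sg = 1 \/ sg = -1) -> K t ->
    (forall s, K s -> 0 <= sg * (s - t)) -> extreme (sg *: U t).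
  move=> sg1 Kt tmin; apply: contrapT => next.
  have sgg : sg * sg = 1 by case: sg1 => ->; ring.
  have H : \forall s \near t, forall ij : 'I_n * 'I_n, (ij.1 < ij.2)%N ->
      0 < sg * (t - s) -> dir_cone (C ij.1) (C ij.2) (U s).
    apply: (@filter_forall R ('I_n * 'I_n)%type (fun ij s => (ij.1 < ij.2)%N ->
      0 < sg * (t - s) -> dir_cone (C ij.1) (C ij.2) (U s)) (nbhs t)) => -[i j].
    have [ij|ij] /= := boolP (i < j)%N; last exact: nearW.
    have [x [y [Cx Cy lt]]] : exists x y, [/\ C i x, C j y
        & cross (sg *: U t) (y - x) < 0].
      apply: contrapT => nex; apply: next; exists i, j; split => // x y Cx Cy.
      by rewrite leNgt; apply/negP => lt; apply: nex; exists x, y.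
    have SU : sg *: U s @[s --> t] --> sg *: U t by apply: cvgZr; exact: Ucvg.
    have H : \forall s \near t, cross (sg *: U s) (y - x) < 0.
      exact: (near_cross_lt SU (cvg_cst (y - x)) lt).
    apply: filterS H => s; rewrite crossZl => lts _ st.
    rewrite crossZl in lt.
    have [_ cD] := cones_pointed ij.
    have Dv : dir_cone (C i) (C j) (y - x) by exists x, y, 1; rewrite scale1r.
    have a0 : 0 < - (sg * cross (U t) (y - x)) by rewrite oppr_gt0.
    have b0 : 0 < - (sg * cross (U s) (y - x)) by rewrite oppr_gt0.
    have -> : U s = (- (sg * cross (U t) (y - x)))^-1 *:
        ((sg * (t - s)) *: (y - x) + (- (sg * cross (U s) (y - x))) *: U t).
      have an0 := lt0r_neq0 a0.
      apply: (scalerI an0); rewrite scalerA divff // scale1r -UU.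
      move: (y - x) (U s) (U t) => v a b.
      by apply: rV2_eq; rewrite /cross !mxE; ring.
    apply: pointed_coneZ; rewrite ?invr_gt0 //; first exact: cones_pointed.
    by apply: cD => //; [exact: Kt|exact: ltW|exact: ltW|exact: addr_gt0].
  move/nbhs_ballP: H => [e /= e0 sub].
  have bs : ball t e (t - sg * (e / 2)).
    rewrite /ball /= opprB addrC subrK normrM.
    have -> : `|sg| = 1 by case: sg1 => ->; rewrite ?normrN normr1.
    by rewrite mul1r ger0_norm; lra.
  have Ks : K (t - sg * (e / 2)).
    move=> i j ij; apply: (sub _ bs (i, j)) => //=.
    rewrite opprB addrC subrK mulrA sgg; lra.
  have := tmin _ Ks; rewrite addrAC subrr add0r mulrN mulrA sgg; lra.
exists w, h, (inf K), (sup K); split=> //.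
- exact: (ge_inf infK.2).
- rewrite -[_ - _]scale1r; apply: (ext 1 (inf K)) => //; first by left.
  by move=> s Ks; rewrite mul1r subr_ge0; exact: (ge_inf infK.2).
- rewrite -[X in extreme X]scaleN1r; apply: (ext (-1) (sup K)) => //; first by right.
  by move=> s Ks; rewrite mulN1r opprB subr_ge0; exact: (ub_le_sup supK.2).
move=> t /andP[l1 l2] i j ij.
have := Kinf _ _ ij; have := Ksup _ _ ij.
have [e|ne] := eqVneq (inf K) (sup K).
  by have -> : t = inf K by apply/eqP; rewrite eq_le l1 e l2.
have lt : 0 < sup K - inf K by rewrite subr_gt0 lt_neqAle ne (le_trans l1).
move=> Ds Di; have [_ cD] := cones_pointed ij.
have -> : w - t *: h = ((t - inf K) / (sup K - inf K)) *: U (sup K)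
    + ((sup K - t) / (sup K - inf K)) *: U (inf K).
  have ltn0 := lt0r_neq0 lt.
  by apply: rV2_eq; rewrite /U !mxE; field.
apply: cD => //; rewrite ?divr_ge0 ?(ltW lt) ?subr_ge0 //.
by rewrite -mulrDl divr_gt0 //; lra.
Qed.

Theorem ordered_transversal : exists u c, [/\ u != 0,
  forall i, stab (Ok i) u c &
  forall i j, (i < j)%N -> dir_cone (C i) (C j) u].
Proof.
have [w [h [t0 [t1 [t01 U0 e0 e1 ord]]]]] := ordered_arc.
pose U t := w - t *: h.
have Ucvg t : U s @[s --> t] --> U t.
  apply: cvgB; first exact: cvg_cst.
  by apply: cvgZl; exact: cvg_id.
have NUcvg t : - U s @[s --> t] --> - U t by apply: cvgN; exact: Ucvg.
have [[t tt [c tc]]|ngood] := pselect (exists2 t, t0 <= t <= t1 &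
    exists c, forall i, stab (Ok i) (U t) c).
  by exists (U t), c; split; [exact: U0|exact: tc|exact: (ord t tt)].
have ng t : t0 <= t <= t1 -> ~ exists c, forall i, stab (Ok i) (U t) c.
  by move=> tt tc; apply: ngood; exists t.
(* [beyond (- U t)] holds at [t0], where the other alternatives are excluded, and must fail at [t1].
   It is open, and so is its complement in the segment, where the other two alternatives hold. *)
exfalso; apply: (extreme_not_beyond e1).
apply: (@segment_clopen _ t0 t1 (fun t => beyond (- U t))) => //.
- have t00 : t0 <= t0 <= t1 by rewrite lexx.
  have [b|//|[i st]] := direction_trichotomy (U0 t0) (ng t0 t00).
    by case: (extreme_not_beyond e0 b).
  by case: (extreme_not_straddled (U0 t0) e0 st).
- by move=> t _; apply: (@near_beyond (fun t => - U t)).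
move=> t tt nb.
have [b|//|[i st]] := direction_trichotomy (U0 t) (ng t tt).
  have := near_beyond (Ucvg t) b.
  by apply: filterS => s /beyondN ? _.
have := near_straddled (U0 t) (Ucvg t) st.
apply: filterS => s /straddledN sb _.
by apply: (straddled_not_beyond _ sb); rewrite oppr_eq0; exact: U0.
Qed.

End OrderedTransversal.

(** * Side conditions from monotone continuous functions *)

Section HausdorffSlices.
Context {R : realType}.
Implicit Types (u v w x y z : 'rV[R]_2) (c e s : R) (A B C K : set 'rV[R]_2)
  (f : set 'rV[R]_2 -> R).

(** * Euclidean norm and Hausdorff distance *)

Lemma cvg_euclid_norm (T : Type) (F : set_system T) {FF : Filter F}
    (g : T -> 'rV[R]_2) x : g @ F --> x ->
  euclid_norm (g t) @[t --> F] --> euclid_norm x.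
Proof.
move=> gx; have coord j : g t 0 j @[t --> F] --> x 0 j.
  by apply: (cvg_comp g (fun x => x 0 j) gx); exact: coord_continuous.
have sq j : g t 0 j ^+ 2 @[t --> F] --> x 0 j ^+ 2.
  exact: (cvgM (coord j) (coord j)).
exact: (cvg_comp _ _ (cvgD (sq 0) (sq 1)) (@sqrt_continuous R _)).
Qed.

Lemma euclid_norm0 : euclid_norm 0 = 0 :> R.
Proof. by rewrite /euclid_norm !mxE expr0n /= addr0 sqrtr0. Qed.

Lemma euclid_normN x : euclid_norm (- x) = euclid_norm x.
Proof. by rewrite /euclid_norm !mxE !sqrrN. Qed.

Lemma euclid_norm_ge0 x : 0 <= euclid_norm x.
Proof. exact: sqrtr_ge0. Qed.

Lemma euclid_normZ s x : 0 <= s -> euclid_norm (s *: x) = s * euclid_norm x.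
Proof.
move=> s0; rewrite /euclid_norm !mxE !exprMn -mulrDr sqrtrM ?sqr_ge0 //.
by rewrite sqrtr_sqr ger0_norm.
Qed.

Lemma near_euclid_norm_lt (T : Type) (F : set_system T) {FF : Filter F}
    (g : T -> 'rV[R]_2) x y e : g @ F --> x -> euclid_norm (x - y) < e ->
  \forall t \near F, euclid_norm (g t - y) < e.
Proof.
move=> gx lt.
have l1 : (g t - y) @[t --> F] --> x - y by apply: cvgB; [|exact: cvg_cst].
exact: (cvgr_lt _ (cvg_euclid_norm l1)).
Qed.

Lemma hausdorff_dist_lt A B (r d : R) : 0 <= r -> r < d ->
  (forall x, A x -> exists2 y, B y & euclid_norm (x - y) <= r) ->
  (forall y, B y -> exists2 x, A x & euclid_norm (x - y) <= r) ->
  (hausdorff_dist A B < d%:E)%E.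
Proof.
move=> r0 rd AB BA; apply: (@le_lt_trans _ _ r%:E); last by rewrite lte_fin.
rewrite /hausdorff_dist !ge_max lee_fin r0 /=; apply/andP; split.
  apply: ge_ereal_sup => _ [x /AB[y By xy] <-]; apply: ge_ereal_inf.
  by exists (euclid_norm (x - y))%:E; [exists y|rewrite lee_fin].
apply: ge_ereal_sup => _ [y /BA[x Ax xy] <-]; apply: ge_ereal_inf.
by exists (euclid_norm (x - y))%:E; [exists x|rewrite lee_fin].
Qed.

(** The right part of [C]; the left part is [slice C (- u) (- c)]. *)
Definition slice C u c : set 'rV[R]_2 := C `&` [set x | cross u x <= c].

Lemma slice_convex C u c : convex_set C -> convex_set (slice C u c).
Proof.
move=> /convex_setP cC; apply/convex_setP => x y s [Cx /= xc] [Cy /= yc] s0 s1.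
by split; [exact: cC|rewrite /= !crossE; nra].
Qed.

Lemma sliceS C u u' c c' : (forall x, C x -> cross u x <= c -> cross u' x <= c') ->
  slice C u c `<=` slice C u' c'.
Proof. by move=> h x [Cx /= xc]; split=> //=; exact: h. Qed.

Lemma slice_nonempty_limit C u c : compact C ->
  (forall e, 0 < e -> slice C u (c + e) !=set0) -> slice C u c !=set0.
Proof.
move=> cC ne; have [z [Cz _]] := ne 1 ltr01.
have [x Cx xm] := compact_cross_min u cC (ex_intro _ z Cz).
exists x; split=> //=; apply/ler_addgt0Pr => e /ne[y [Cy /= yc]].
by rewrite (le_trans (xm y Cy)).
Qed.

Lemma slice_outer C u c d : compact C -> 0 < d ->
  exists2 e, 0 < e & (hausdorff_dist (slice C u c) (slice C u (c + e)) < d%:E)%E.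
Proof.
move=> cC d0.
have : \forall t \near c, forall x, C x -> cross u x <= t ->
    exists2 y, slice C u c y & euclid_norm (x - y) < d / 2.
  apply: compact_near => // x Cx; have [xc|xc] := lerP (cross u x) c.
    have H : \forall z \near (x, c), euclid_norm (z.1 - x) < d / 2.
      have l : z.1 @[z --> (x, c)] --> x by exact: cvg_fst.
      apply: (near_euclid_norm_lt l).
      by rewrite subrr euclid_norm0 divr_gt0.
    by apply: filterS H => z ? _; exists x.
  have l : z.1 @[z --> (x, c)] --> x by exact: cvg_fst.
  have l1 : cross u z.1 @[z --> (x, c)] --> cross u x.
    exact: (cvg_cross (cvg_cst u) l).
  have l2 : z.2 @[z --> (x, c)] --> c by exact: cvg_snd.
  have l3 : (z.2 - cross u z.1) @[z --> (x, c)] --> c - cross u x by exact: cvgB.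
  have : c - cross u x < 0 by rewrite subr_lt0.
  move=> /(cvgr_lt _ l3); apply: filterS => z; rewrite subr_lt0 => lt /=.
  by rewrite leNgt lt.
move=> /nbhs_ballP[e /= e0 sub]; exists (e / 2); first by rewrite divr_gt0.
apply: (@hausdorff_dist_lt _ _ (d / 2)); [lra|lra| |].
  move=> x [Cx /= xc]; exists x; last by rewrite subrr euclid_norm0; lra.
  by split=> //=; lra.
move=> y [Cy /= yc].
have [|z sz zy] := sub (c + e / 2) _ y Cy yc.
  by rewrite /ball /= opprD addrA subrr add0r normrN ger0_norm; lra.
by exists z => //; rewrite ltW // -opprB euclid_normN.
Qed.

(** Points of the slice are moved slightly towards [w], off the boundary line. If [C] lay in that
    line, the smaller slices would be empty, at infinite distance. *)
Lemma slice_inner C u c d w : compact C -> convex_set C -> C w -> cross u w < c ->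
  0 < d ->
  exists2 e, 0 < e & (hausdorff_dist (slice C u c) (slice C u (c - e)) < d%:E)%E.
Proof.
move=> cC /convex_setP vC Cw wc d0.
have : \forall t \near c, forall x, C x -> cross u x <= c ->
    exists2 y, slice C u t y & euclid_norm (x - y) < d / 2.
  apply: compact_near => // x Cx; have [xc|xc] := lerP (cross u x) c; last first.
    have H : \forall z \near (x, c), c < cross u z.1.
      have l : z.1 @[z --> (x, c)] --> x by exact: cvg_fst.
      exact: (near_cross_gt (cvg_cst u) l xc).
    by apply: filterS H => z lt; rewrite leNgt lt.
  have E0 := euclid_norm_ge0 (x - w); set E := euclid_norm (x - w) in E0.
  (* Chosen so that [s * E < d / 2]. *)
  pose s := d / 2 / (d / 2 + E + 1).
  have D0 : 0 < d / 2 + E + 1 by lra.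
  have s0 : 0 < s by rewrite divr_gt0 //; lra.
  have s1 : s <= 1 by rewrite ler_pdivrMr //; lra.
  pose y := s *: w + (1 - s) *: x.
  have Cy : C y by apply: vC => //; exact: ltW.
  have yc : cross u y < c by rewrite /y !crossE; nra.
  have xy : euclid_norm (x - y) < d / 2.
    have -> : x - y = s *: (x - w) by apply: rV2_eq; rewrite /y !mxE; ring.
    rewrite euclid_normZ ?(ltW s0) // -/E /s mulrAC ltr_pdivrMr //; nra.
  have H1 : \forall z \near (x, c), euclid_norm (z.1 - y) < d / 2.
    have l : z.1 @[z --> (x, c)] --> x by exact: cvg_fst.
    exact: (near_euclid_norm_lt l xy).
  have H2 : \forall z \near (x, c), cross u y < z.2.
    have : z.2 @[z --> (x, c)] --> c by exact: cvg_snd.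
    by move=> /cvgr_gt; apply.
  near=> z => _; exists y; last by near: z.
  by split=> //=; apply: ltW; near: z.
move=> /nbhs_ballP[e /= e0 sub]; exists (e / 2); first by rewrite divr_gt0.
apply: (@hausdorff_dist_lt _ _ (d / 2)); [lra|lra| |].
  move=> x [Cx /= xc].
  have [|y sy xy] := sub (c - e / 2) _ x Cx xc.
    by rewrite /ball /= opprB addrC subrK ger0_norm; lra.
  by exists y => //; exact: ltW.
move=> x [Cx /= xc]; exists x; last by rewrite subrr euclid_norm0; lra.
by split=> //=; lra.
Unshelve. all: by end_near. Qed.

Lemma slice_limit_outer C u c f (a : R) : compact C -> convex_set C ->
  hausdorff_continuous f ->
  (forall e, 0 < e -> a <= f (slice C u (c + e))) -> a <= f (slice C u c).
Proof.
move=> cC vC fc H; rewrite leNgt; apply/negP => lt.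
have [|d d0 dP] := fc _ (@slice_convex C u c vC) (a - f (slice C u c)).
  by rewrite subr_gt0.
have [e e0 /dP] := slice_outer u c cC d0.
move=> /(_ (slice_convex vC)).
by have := H e e0; rewrite ltr_norml => ? /andP[]; lra.
Qed.

Lemma slice_limit_inner C u c f (a : R) w : compact C -> convex_set C ->
  hausdorff_continuous f -> C w -> cross u w < c ->
  (forall e, 0 < e -> a <= f (slice C u (c - e))) -> a <= f (slice C u c).
Proof.
move=> cC vC fc Cw wc H; rewrite leNgt; apply/negP => lt.
have [|d d0 dP] := fc _ (@slice_convex C u c vC) (a - f (slice C u c)).
  by rewrite subr_gt0.
have [e e0 /dP] := slice_inner cC vC Cw wc d0.
move=> /(_ (slice_convex vC)).
by have := H e e0; rewrite ltr_norml => ? /andP[]; lra.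
Qed.

(** For convex [C], nonempty parts mean that the line meets [C], which the values of [f] do not
    imply. *)
Definition stab_cond C f a u c := [/\ slice C u c !=set0,
  slice C (- u) (- c) !=set0, a <= f (slice C u c) & a <= f (slice C (- u) (- c))].

Definition side_inc C f a u c := slice C u c !=set0 /\ a <= f (slice C u c).

(** For decreasing [f], a large value on the left part says that this part is not too large, hence
    the right one not too small; so [f] is evaluated on the opposite side. *)
Definition side_dec C f a u c :=
  slice C u c !=set0 /\ a <= f (slice C (- u) (- c)).

Lemma stab_incE C f a u c : stab (side_inc C f a) u c <-> stab_cond C f a u c.
Proof. by split=> [[[? ?] [? ?]]|[? ? ? ?]]; split. Qed.

Lemma stab_decE C f a u c : stab (side_dec C f a) u c <-> stab_cond C f a u c.
Proof.
rewrite /stab /side_dec !opprK.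
by split=> [[[? ?] [? ?]]|[? ? ? ?]]; split.
Qed.

Lemma slice_meets C (Q : 'rV[R]_2 -> R -> Prop) :
  side_meets C (fun u c => slice C u c !=set0 /\ Q u c).
Proof. by move=> u c [[x [Cx xc]] _]; exists x. Qed.

Lemma conv_gt (c a b s : R) : 0 <= s -> s <= 1 -> c < a -> c < b ->
  c < s * a + (1 - s) * b.
Proof.
move=> s0 s1 ca cb; have s1' : 0 <= 1 - s by lra.
have [ab|/ltW ab] := lerP a b.
  have ba : 0 <= b - a by lra.
  by have := mulr_ge0 s1' ba; lra.
have ba : 0 <= a - b by lra.
by have := mulr_ge0 s0 ba; lra.
Qed.

(** If neither half of [C] cut by the line [(u', c')] lies in the right part for [(u, c)], a segment
    joining points outside that part meets the line [(u', c')] at a point [z] left of [(u, c)]. The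
    lines, not being parallel, then cross inside [C], between [p] and [z]. *)
Lemma side_inc_rotates C f a : convex_set C ->
  (forall K1 K2, convex_set K1 -> convex_set K2 -> K1 `<=` K2 -> f K1 <= f K2) ->
  side_rotates C (side_inc C f a).
Proof.
move=> vC fm u c u' c' p u0 u0' /stab_incE[_ _ a1 a2] Cp pc' pc npar.
split; first by exists p.
suff [s|s] : slice C u' c' `<=` slice C u c \/ slice C (- u') (- c') `<=` slice C u c.
- by apply: le_trans a1 _; apply: fm => //; exact: slice_convex.
- by apply: le_trans a2 _; apply: fm => //; exact: slice_convex.
apply: contrapT => /not_orP[/existsNP[x /not_implyP[[Cx /= xc'] nx]]].
move=> /existsNP[y /not_implyP[[Cy /=]]]; rewrite crossNl lerN2 => yc' ny.
have {}nx : c < cross u x by rewrite ltNge; apply/negP => h; apply: nx.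
have {}ny : c < cross u y by rewrite ltNge; apply/negP => h; apply: ny.
have [s [s0 s1 Cz zc']] := convex_cross_ivt vC Cx Cy xc' yc'.
have zc : c < cross u (s *: x + (1 - s) *: y).
  by rewrite !crossE; exact: conv_gt.
move: (s *: x + (1 - s) *: y) Cz zc' zc => z Cz zc' zc.
have [t [_ _ Cq qc]] := convex_cross_ivt vC Cp Cz pc (ltW zc).
have [e|ne] := eqVneq (cross u' u) 0.
  have [k kE] := cross_eq0P u0' e.
  by move: pc zc; rewrite kE !crossZl pc' zc'; lra.
apply: (npar _ _ Cq qc); first by rewrite crossC oppr_eq0.
by rewrite !crossE pc' zc'; ring.
Qed.

(** The dual argument: the left part for [(u, c)] must lie in one of the halves of [C] cut by
    [(u', c')]. *)
Lemma side_dec_rotates C f a : convex_set C ->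
  (forall K1 K2, convex_set K1 -> convex_set K2 -> K1 `<=` K2 -> f K2 <= f K1) ->
  side_rotates C (side_dec C f a).
Proof.
move=> vC fm u c u' c' p u0 u0' /stab_decE[_ _ a1 a2] Cp pc' pc npar.
split; first by exists p.
suff [s|s] : slice C (- u) (- c) `<=` slice C u' c' \/
    slice C (- u) (- c) `<=` slice C (- u') (- c').
- by apply: le_trans a1 _; apply: fm => //; exact: slice_convex.
- by apply: le_trans a2 _; apply: fm => //; exact: slice_convex.
apply: contrapT => /not_orP[/existsNP[y /not_implyP[[Cy /= yc] ny]]].
move=> /existsNP[x /not_implyP[[Cx /= xc] nx]].
rewrite !crossNl !lerN2 in xc yc.
have {}ny : c' < cross u' y by rewrite ltNge; apply/negP => h; apply: ny.
have {}nx : cross u' x < c'.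
  by rewrite ltNge; apply/negP => h; apply: nx; split=> //=; rewrite crossNl lerN2.
have [e|ne] := eqVneq (cross u' u) 0.
  have [k kE] := cross_eq0P u0' e.
  move: pc yc xc; rewrite kE !crossZl pc' => pc yc xc.
  have [k0|k0] := ltrP 0 k.
    have d0 : 0 < c' - cross u' x by lra.
    by have := mulr_gt0 k0 d0; lra.
  have k0' : 0 < - k.
    rewrite oppr_gt0 lt_neqAle k0 andbT; apply: contra u0 => /eqP k00.
    by rewrite kE k00 scale0r.
  have d0 : 0 < cross u' y - c' by lra.
  by have := mulr_gt0 k0' d0; lra.
have [s [s0 s1 Cz zc']] := convex_cross_ivt vC Cx Cy (ltW nx) (ltW ny).
have zc : c <= cross u (s *: x + (1 - s) *: y) by rewrite !crossE; nra.
move: (s *: x + (1 - s) *: y) Cz zc' zc => z Cz zc' zc.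
have [t [_ _ Cq qc]] := convex_cross_ivt vC Cp Cz pc zc.
apply: (npar _ _ Cq qc); first by rewrite crossC oppr_eq0.
by rewrite !crossE pc' zc'; ring.
Qed.

(** * Closedness of the side conditions *)

Lemma ok_limit_meets C Ok u c : compact C -> side_meets C Ok ->
  ok_limit C Ok u c -> slice C u c !=set0.
Proof.
move=> cC mC lim; apply: slice_nonempty_limit => // e /lim[u' [c' [/mC[x Cx xc] h]]].
exists x; split=> //=; have := h x Cx; rewrite ler_norml => /andP[]; lra.
Qed.

Lemma side_inc_closed C f a : compact C -> convex_set C ->
  hausdorff_continuous f ->
  (forall K1 K2, convex_set K1 -> convex_set K2 -> K1 `<=` K2 -> f K1 <= f K2) ->
  side_closed C (side_inc C f a).
Proof.
move=> cC vC fc fm u c u0 lim _; split.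
  by apply: ok_limit_meets lim => //; exact: slice_meets.
apply: slice_limit_outer => // e /lim[u' [c' [[_ a1] h]]].
apply: le_trans a1 _; apply: fm; [exact: slice_convex..|].
apply: sliceS => x /h; rewrite ler_norml => /andP[]; lra.
Qed.

(** Shrunken parts are contained in the nearby ones, so [f] is at least [a] on them, and
    [slice_inner] applies if the left part has a point off the line. If it has none, [a <= f C]
    suffices; this follows in the same way from the right part, or from the hypothesis when [C] lies
    in the line. *)
Lemma side_dec_closed C f a u c : compact C -> convex_set C ->
  hausdorff_continuous f ->
  (forall K1 K2, convex_set K1 -> convex_set K2 -> K1 `<=` K2 -> f K2 <= f K1) ->
  ((forall x, C x -> cross u x = c) -> a <= f C) ->
  ok_limit C (side_dec C f a) u c -> ok_limit C (side_dec C f a) (- u) (- c) ->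
  side_dec C f a u c.
Proof.
move=> cC vC fc fm flat lim limN; split.
  by apply: ok_limit_meets lim => //; exact: slice_meets.
have H1 e : 0 < e -> a <= f (slice C (- u) (- c - e)).
  move=> /lim[u' [c' [[_ a1] h]]]; apply: le_trans a1 _.
  apply: fm; [exact: slice_convex..|]; apply: sliceS => x /h.
  by rewrite !crossNl ler_norml => /andP[]; lra.
have H2 e : 0 < e -> a <= f (slice C u (c - e)).
  move=> /limN[u' [c' [[_ a1] h]]]; apply: le_trans a1 _.
  apply: fm; [exact: slice_convex..|]; apply: sliceS => x /h.
  by rewrite !crossNl ler_norml => /andP[]; lra.
have [[w [Cw wc]]|nw] := pselect (exists w, C w /\ cross (- u) w < - c).
  exact: (slice_limit_inner cC vC fc Cw wc).
have le x : C x -> cross u x <= c.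
  move=> Cx; rewrite leNgt; apply/negP => lt; apply: nw.
  by exists x; rewrite crossNl ltrN2.
suff aC : a <= f C.
  by apply: le_trans aC _; apply: fm => //; [exact: slice_convex|move=> x []].
have [[w [Cw wc]]|nw'] := pselect (exists w, C w /\ cross u w < c).
  have := slice_limit_inner cC vC fc Cw wc H2.
  suff -> : slice C u c = C by [].
  by apply/seteqP; split=> [x []//|x Cx]; split=> //=; exact: le.
apply: flat => x Cx; apply/eqP; rewrite eq_le le //= leNgt; apply/negP => lt.
by apply: nw'; exists x.
Qed.

(* If [f] is decreasing and [C] lies on a line [l] with [f C < a], the stabbers
   of [C] are the lines other than [l] through a segment [Z] of [C]; they are
   not closed, and all the lines through [Z] take their place. *)
Lemma side_dec_flat C f a d : compact C -> convex_set C ->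
  hausdorff_continuous f ->
  (forall K1 K2, convex_set K1 -> convex_set K2 -> K1 `<=` K2 -> f K2 <= f K1) ->
  d != 0 -> (forall x y, C x -> C y -> cross d x = cross d y) -> f C < a ->
  exists Z : set 'rV[R]_2, [/\ compact Z, convex_set Z, Z `<=` C,
    forall u c, stab_cond C f a u c -> u != 0 -> cross u d != 0 &
    forall u c z, C z -> cross u z = c -> cross u d != 0 ->
      Z z <-> stab_cond C f a u c].
Proof.
move=> cC vC fc fm d0 flat fCa.
have [v v0 dv] := cross_neq0P d0.
have vd : cross v d != 0 by rewrite crossC dv oppr_eq0 oner_eq0.
have coord x z : C x -> C z -> exists k, x = z + k *: d.
  move=> Cx Cz; have [|k kE] := @cross_eq0P _ d (x - z) d0.
    by rewrite crossDr crossNr (flat x z) // subrr.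
  by exists k; rewrite -kE addrC subrK.
have full u c : (forall x, C x -> cross u x = c) -> slice C u c = C.
  by move=> h; apply/seteqP; split=> [x []//|x Cx]; split=> //=; rewrite h.
have npar u c : stab_cond C f a u c -> u != 0 -> cross u d != 0.
  move=> st u0; apply/eqP => ud.
  have [x Cx xc] : exists2 x, C x & cross u x = c.
    apply: (stab_meets (Ok := side_dec C f a) vC); last exact/stab_decE.
    exact: slice_meets.
  have [_ _ + _] := st; rewrite full; first lra.
  by move=> y Cy; have [k ->] := coord y x Cy Cx; rewrite !crossE ud xc; ring.
(* A transversal line through [z] cuts the segment into the same two parts whatever its direction,
   exchanged when the orientation is opposite. *)
have transfer u w z : C z -> cross u d != 0 -> cross w d != 0 ->
    stab_cond C f a u (cross u z) -> stab_cond C f a w (cross w z).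
  move=> Cz ud wd [_ _ a1 a2].
  have sub u' w' : 0 < cross u' d * cross w' d ->
      slice C w' (cross w' z) `<=` slice C u' (cross u' z).
    move=> uw; apply: sliceS => x Cx; have [k ->] := coord x z Cx Cz.
    by rewrite !crossDr !gerDl !crossZr; nra.
  have ne w' c' : c' = cross w' z -> slice C w' c' !=set0.
    by move=> ->; exists z; split=> /=.
  rewrite -!crossNl in a1 a2 *.
  have mono u' w' : 0 < cross u' d * cross w' d ->
      a <= f (slice C u' (cross u' z)) -> a <= f (slice C w' (cross w' z)).
    move=> uw; move/le_trans; apply; apply: fm; [exact: slice_convex..|].
    exact: sub.
  have : cross u d * cross w d != 0 by rewrite mulf_neq0.
  rewrite /stab_cond -crossNl neq_lt => /orP[lt|gt].
    split; [exact: ne|exact: ne|apply: mono a2|apply: mono a1].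
      by rewrite crossNl mulNr oppr_gt0.
    by rewrite crossNl mulrN oppr_gt0.
  split; [exact: ne|exact: ne|exact: mono a1|apply: mono a2].
  by rewrite !crossNl mulrNN.
pose Z := [set z | C z /\ stab_cond C f a v (cross v z)].
exists Z; split=> //.
- apply: (subclosed_compact _ cC) => [|z []//].
  move=> x Zx.
  have Cx : C x.
    apply: (compact_closed (@norm_hausdorff _ _) cC).
    by apply: closureS Zx => z [].
  have lim e : 0 < e -> exists2 z, Z z & `|cross v z - cross v x| <= e.
    move=> e0.
    have : nbhs x [set z | `|cross v z - cross v x| <= e].
      have l := @cross_continuous R v x.
      by have := @cvgr_distC_le _ _ _ _ _ _ _ l e e0; apply.
    by move=> /Zx[z [Zz ?]]; exists z.
  have flat' : (forall y, C y -> cross v y = cross v x) -> a <= f C.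
    move=> h; have [z [Cz [_ _ a1 _]] _] := lim 1 ltr01.
    by move: a1; rewrite full // => y Cy; rewrite !h.
  split=> //; apply/stab_decE.
  have l1 : ok_limit C (side_dec C f a) v (cross v x).
    move=> e /lim[z [Cz /stab_decE[s1 _]] ze].
    exists v, (cross v z); split=> // y _; rewrite ler_norml.
    by move: ze; rewrite ler_norml => /andP[]; lra.
  have l2 : ok_limit C (side_dec C f a) (- v) (- cross v x).
    move=> e /lim[z [Cz /stab_decE[_ s2]] ze].
    exists (- v), (- cross v z); split=> // y _; rewrite ler_norml.
    by move: ze; rewrite ler_norml => /andP[]; lra.
  split; apply: side_dec_closed => //; rewrite ?opprK //.
  by move=> h; apply: flat' => y /h; rewrite crossNl => /oppr_inj.
- apply/convex_setP => z1 z2 s [C1 [_ _ a1 b1]] [C2 [_ _ a2 b2]] s0 s1.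
  have Cz : C (s *: z1 + (1 - s) *: z2) by have /convex_setP := vC; apply.
  have ne w' c' z : C z -> c' = cross w' z -> slice C w' c' !=set0.
    by move=> ? ->; exists z; split=> /=.
  (* The part cut off at an intermediate point is contained in the part cut off at one of the ends,
     and [f] is decreasing. *)
  have mono w : a <= f (slice C w (cross w z1)) -> a <= f (slice C w (cross w z2)) ->
      a <= f (slice C w (cross w (s *: z1 + (1 - s) *: z2))).
    move=> h1 h2; rewrite crossDr !crossZr.
    have s1' : 0 <= 1 - s by lra.
    have [le|/ltW le] := lerP (cross w z1) (cross w z2).
      apply: le_trans h2 _; apply: fm; [exact: slice_convex..|].
      apply: sliceS => x _ xc; apply: le_trans xc _.
      have le' : 0 <= cross w z2 - cross w z1 by lra.
      by have := mulr_ge0 s0 le'; lra.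
    apply: le_trans h1 _; apply: fm; [exact: slice_convex..|].
    apply: sliceS => x _ xc; apply: le_trans xc _.
    have le' : 0 <= cross w z1 - cross w z2 by lra.
    by have := mulr_ge0 s1' le'; lra.
  rewrite -!crossNl in b1 b2.
  split=> //; rewrite /stab_cond -crossNl.
  by split; [exact: (ne _ _ _ Cz)|exact: (ne _ _ _ Cz)|exact: mono|exact: mono].
- by move=> z [].
move=> u c z Cz <- ud; split=> [[_ st]|st].
  exact: (transfer v u).
by split=> //; exact: (transfer u v).
Qed.

(** When a line through [z] is turned about [p], either [z] is not left of the new line, or that
    line crosses the segment from [p] to [z] inside [C]. *)
Lemma through_side_conditions C (Z : set 'rV[R]_2) : convex_set C -> compact Z -> convex_set Z ->
  Z `<=` C -> let Ok := fun u c => exists2 z, Z z & cross u z <= c in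
  [/\ side_meets C Ok, side_rotates C Ok & side_closed C Ok].
Proof.
move=> vC cZ vZ ZC Ok; split.
- by move=> u c [z Zz zc]; exists z => //; exact: ZC.
- move=> u c u' c' p u0 u0' st Cp pc' pc npar.
  have [z Zz zc'] : exists2 z, Z z & cross u' z = c'.
    by apply: (stab_meets vZ) st => ? ? [y Zy ?]; exists y.
  have [zc|zc] := lerP (cross u z) c; first by exists z.
  have [e|ne] := eqVneq (cross u' u) 0.
    have [k kE] := cross_eq0P u0' e.
    by move: pc zc; rewrite kE !crossZl pc' zc'; lra.
  have [s [_ _ Cq qc]] := convex_cross_ivt vC Cp (ZC _ Zz) pc (ltW zc).
  case: (npar _ _ Cq qc); first by rewrite crossC oppr_eq0.
  by rewrite !crossE pc' zc'; ring.
move=> u c u0 lim _.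
have [|z [Zz /= zc]] := @slice_nonempty_limit Z u c cZ; last by exists z.
move=> e /lim[u' [c' [[z Zz zc] h]]]; exists z; split=> //=.
by have := h z (ZC _ Zz); rewrite ler_norml => /andP[]; lra.
Qed.

(** [Ok] describes the actual stabbers and [Ok'] a closed family containing them. Where they may
    differ, [C] lies on a line directed by [d], and all lines through [z] not parallel to [d] are
    actual stabbers, which leaves room for a rotation. *)
Lemma side_conditions_exist C f a : compact C -> convex_set C ->
  hausdorff_continuous f -> convex_monotone f ->
  exists Ok Ok' : 'rV[R]_2 -> R -> Prop,
  [/\ [/\ side_meets C Ok, side_rotates C Ok &
          forall u c, stab Ok u c <-> stab_cond C f a u c],
      [/\ side_meets C Ok', side_rotates C Ok' & side_closed C Ok'],
      forall u c, u != 0 -> stab Ok u c -> stab Ok' u c &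
      (forall u c, u != 0 -> stab Ok' u c -> stab Ok u c) \/
      exists d : 'rV[R]_2, [/\ d != 0, forall x y, C x -> C y -> cross d x = cross d y,
        forall u c, u != 0 -> stab Ok u c -> cross u d != 0 &
        forall u c, stab Ok' u c -> exists z, [/\ C z, cross u z = c &
          forall w, cross w d != 0 -> stab Ok w (cross w z)]]].
Proof.
move=> cC vC fc [fm|fm].
  have sc : [/\ side_meets C (side_inc C f a), side_rotates C (side_inc C f a)
      & side_closed C (side_inc C f a)].
    by split; [exact: slice_meets|exact: side_inc_rotates|exact: side_inc_closed].
  exists (side_inc C f a), (side_inc C f a); split=> //; last by left.
  by have [? ? _] := sc; split=> // u c; exact: stab_incE.
have sm : side_meets C (side_dec C f a) by exact: slice_meets.
have sr : side_rotates C (side_dec C f a) by exact: side_dec_rotates.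
have [[d [d0 flat fCa]]|nflat] := pselect (exists d : 'rV[R]_2, [/\ d != 0,
    forall x y, C x -> C y -> cross d x = cross d y & f C < a]); last first.
  exists (side_dec C f a), (side_dec C f a); split=> //; last by left.
    by split=> // u c; exact: stab_decE.
  split=> // u c u0; apply: side_dec_closed => // h.
  rewrite leNgt; apply/negP => fCa; apply: nflat; exists u; split=> // x y Cx Cy.
  by rewrite !h.
have [Z [cZ vZ ZC npar ZE]] := side_dec_flat cC vC fc fm d0 flat fCa.
have [m' r' c'] := through_side_conditions vC cZ vZ ZC.
exists (side_dec C f a), (fun u c => exists2 z, Z z & cross u z <= c).
split=> //.
- by split=> // u c; exact: stab_decE.
- move=> u c u0 st; have ud := npar _ _ ((stab_decE _ _ _ _ _).1 st) u0.
  have [x Cx xc] := stab_meets vC sm st.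
  have Zx : Z x by apply/(ZE _ _ _ Cx xc ud)/stab_decE.
  by split; exists x => //; rewrite ?crossNl ?xc.
right; exists d; split=> //.
  by move=> u c u0 /stab_decE st; exact: (npar u c).
move=> u c st.
have [z Zz zc] : exists2 z, Z z & cross u z = c.
  by apply: (stab_meets vZ) st => ? ? [y Zy ?]; exists y.
exists z; split=> //; first exact: ZC.
by move=> w wd; apply/stab_decE; apply/(ZE w _ z (ZC _ Zz) erefl wd).
Qed.

End HausdorffSlices.

(** * Rotating a transversal about a point *)

Section Perturbation.
Context {R : realType} (n : nat).
Context (C : 'I_n -> set 'rV[R]_2) (Ok : 'I_n -> 'rV[R]_2 -> R -> Prop).
Context (C_disjoint : forall i j : 'I_n, i != j -> C i `&` C j = set0)
  (C_compact : forall i, compact (C i)) (C_convex : forall i, convex_set (C i))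
  (C_meets : forall i, side_meets (C i) (Ok i))
  (C_rotates : forall i, side_rotates (C i) (Ok i)).
Implicit Types (u v w x y z : 'rV[R]_2) (c e s t : R) (i j k p q : 'I_n).

Definition before p k w :=
  if (p < k)%N then dir_cone (C p) (C k) w else dir_cone (C k) (C p) w.

(** The sign of a step from [C p] to [C k] along a line that meets them in the order of the
    indices. *)
Definition order_sign p k : R := if (p < k)%N then 1 else -1.

Lemma order_sign_sqr p k : order_sign p k * order_sign p k = 1.
Proof. by rewrite /order_sign; case: ifP => _; ring. Qed.

Lemma before_step p k u x y : k != p -> before p k u -> C p x -> C k y ->
  cross u x = cross u y ->
  exists2 m : R, 0 < order_sign p k * m & y - x = m *: u.
Proof.
rewrite /before /order_sign => kp + Cx Cy xy; case: ifP => pk Du.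
  have [|m m0 mE] := dir_cone_stab _ Du Cx Cy xy.
    by apply: dir_cone_pointed => //; apply: C_disjoint; rewrite eq_sym.
  by exists m; rewrite ?mul1r.
have [||m m0 mE] := dir_cone_stab _ Du Cy Cx; last 1 first.
- by exists (- m); [rewrite mulrNN mul1r|rewrite scaleNr -mE opprB].
- by apply: dir_cone_pointed => //; exact: C_disjoint.
- by rewrite xy.
Qed.

(** One side of [C k] is secured by turning the line [(u, c)], the other by turning the common
    stabber [w] of [C p] and [C k]; the small rotation about [z0] goes towards [w], in the sense
    [sg]. *)
Lemma rotate_transversal p u c z0 (sg : R) : u != 0 -> C p z0 ->
  (forall x, C p x -> cross u x = c) ->
  (forall k, k != p -> stab (Ok k) u c) ->
  (forall i j, (i < j)%N -> dir_cone (C i) (C j) u) ->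
  sg * sg = 1 ->
  (forall k, k != p -> exists w cw, [/\ stab (Ok p) w cw, stab (Ok k) w cw,
    before p k w & 0 < sg * cross u w]) ->
  exists v, [/\ cross v u != 0,
    forall k, k != p -> stab (Ok k) v (cross v z0) &
    forall i j, (i < j)%N -> forall x y, C i x -> C j y -> cross v x = cross v y ->
      exists2 m : R, 0 < m & y - x = m *: v].
Proof.
move=> u0 Cz0 flat st ord sgg pairs.
have [g _ ug] := cross_neq0P u0.
pose U t := u + (sg * t) *: g.
have U00 : U 0 = u by rewrite /U mulr0 scale0r addr0.
have Ucvg : U t @[t --> (0 : R)] --> u.
  rewrite -[X in _ --> X]U00; apply: cvgD; first exact: cvg_cst.
  apply: cvgZl; apply: cvgM; first exact: cvg_cst.
  exact: cvg_id.
have cgU t : cross g (U t) = -1 by rewrite !crossE crossC ug; ring.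
have cUu t : cross (U t) u = - (sg * t) by rewrite !crossE (crossC g u) ug; ring.
have Unz t : U t != 0.
  apply/eqP => e; move/eqP: (cgU t).
  by rewrite e cross0r eq_sym oppr_eq0 oner_eq0.
have near_ord : \forall t \near (0 : R), forall ij : 'I_n * 'I_n,
    (ij.1 < ij.2)%N -> forall x y, C ij.1 x -> C ij.2 y ->
    cross (U t) x = cross (U t) y -> exists2 m : R, 0 < m & y - x = m *: U t.
  apply: (@filter_forall R ('I_n * 'I_n)%type (fun ij t =>
    (ij.1 < ij.2)%N -> forall x y, C ij.1 x -> C ij.2 y ->
    cross (U t) x = cross (U t) y -> exists2 m : R, 0 < m & y - x = m *: U t)
    (nbhs (0 : R))) => -[i j] /=.
   have [ij|ij] := boolP (i < j)%N; last exact: nearW.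
  have pD : pointed_cone (dir_cone (C i) (C j)).
    by apply: dir_cone_pointed => //; apply: C_disjoint; apply: ltn_ord_neq.
  suff : \forall t \near (0 : R), forall z : 'rV[R]_2 * 'rV[R]_2, (C i `*` C j) z ->
      cross (U t) (z.2 - z.1) != 0 \/ cross g (z.2 - z.1) < 0.
    apply: filterS => t tP _ x y Cx Cy xy.
    have e : cross (U t) (y - x) = 0 by rewrite crossDr crossNr xy subrr.
    have [m mE] := cross_eq0P (Unz t) e.
    exists m => //; have [] := tP (x, y); first by [].
      by rewrite /= e eqxx.
    by rewrite /= mE crossZr cgU; lra.
  apply: compact_near; first exact: compact_setX.
  move=> -[x y] [/= Cx Cy].
  pose h (z : 'rV[R]_2 * 'rV[R]_2) : 'rV[R]_2 := z.2 - z.1.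
  have hz : h @ (x, y) --> h (x, y) by apply: cvgB; [exact: cvg_snd|exact: cvg_fst].
  have UF : U z.2 @[z --> ((x, y), (0 : R))] --> u.
    by apply: (cvg_comp snd U) Ucvg; exact: cvg_snd.
  have hF : h z.1 @[z --> ((x, y), (0 : R))] --> h (x, y).
    by apply: (cvg_comp fst h) hz; exact: cvg_fst.
  case: (ltrgtP (cross u (y - x)) 0) => [lt|gt|e].
  - have H : \forall z \near ((x, y), (0 : R)), cross (U z.2) (h z.1) < 0.
      exact: (near_cross_lt UF hF lt).
    by apply: filterS H => z ?; left; rewrite lt_eqF.
  - have H : \forall z \near ((x, y), (0 : R)), 0 < cross (U z.2) (h z.1).
      exact: (near_cross_gt UF hF gt).
    by apply: filterS H => z ?; left; rewrite gt_eqF.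
  have [|m m0 mE] := dir_cone_stab pD (ord _ _ ij) Cx Cy.
    by apply/eqP; rewrite -subr_eq0 -crossNr -crossDr -opprB crossNr e oppr0.
  have klt : cross g (y - x) < 0.
    by rewrite mE crossZr crossC ug; lra.
  have H : \forall z \near ((x, y), (0 : R)), cross g (h z.1) < 0.
    exact: (near_cross_lt (cvg_cst g) hF klt).
  by apply: filterS H => z ?; right.
have near_stab : \forall t \near (0 : R), forall k, k != p -> 0 < t ->
    stab (Ok k) (U t) (cross (U t) z0).
  apply: (@filter_forall R 'I_n (fun k t => k != p -> 0 < t ->
    stab (Ok k) (U t) (cross (U t) z0)) (nbhs (0 : R))) => k.
  have [->|kp] := eqVneq k p; first exact: nearW.
  have pk : p != k by rewrite eq_sym.
  have Cpk (q : 'rV[R]_2) : C p q -> C k q -> False.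
    move=> Cp Ck; have : (C p `&` C k) q by [].
    by rewrite C_disjoint.
  have [w [cw [sp sk bw uw]]] := pairs k kp.
  have wn0 : w != 0.
    by apply/eqP => w0; move: uw; rewrite w0 cross0r mulr0 ltxx.
  have uwn0 : cross u w != 0.
    by apply/eqP => e; move: uw; rewrite e mulr0 ltxx.
  have [z Cz zc] := stab_meets (@C_convex p) (@C_meets p) sp.
  have [y Cy yc] := stab_meets (@C_convex k) (@C_meets k) sk.
  have [|nu nu0 nuE] := before_step kp bw Cz Cy; first by rewrite zc yc.
  have [x Cx xc] := stab_meets (@C_convex k) (@C_meets k) (st k kp).
  have bu : before p k u.
    rewrite /before; case: ifP => lpk; first exact: ord.
    apply: ord; rewrite ltn_neqAle leqNgt lpk andbT.
    by apply: contra kp => /eqP e; apply/eqP/val_inj.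
  have [|mu mu0 muE] := before_step kp bu Cz0 Cx; first by rewrite flat // xc.
  pose r := order_sign p k * sg.
  have rr : r * r = 1.
    by rewrite /r mulrACA order_sign_sqr sgg mulr1.
  have n1 : \forall t \near (0 : R), 0 < cross (r *: U t) (y - z0).
    have l : (r *: U t) @[t --> (0 : R)] --> r *: u by apply: cvgZr.
    apply: (near_cross_gt l (cvg_cst (y - z0))).
    have -> : y - z0 = (y - z) + (z - z0) by rewrite addrA subrK.
    rewrite nuE crossZl crossDr crossZr (_ : cross u (z - z0) = 0); last first.
      by rewrite crossDr crossNr !flat // subrr.
    have -> : r * (nu * cross u w + 0) = (order_sign p k * nu) * (sg * cross u w).
      by rewrite /r; ring.
    exact: mulr_gt0.
  (* A point of [C k] on the stabber [w] and, in the limit, on the line [(u, c)] would be [z], which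
     belongs to [C p]. *)
  have n2 : \forall t \near (0 : R), forall q : 'rV[R]_2, C k q ->
      cross (U t) (q - z0) != 0 \/ cross w q != cw.
    apply: compact_near => // q Cq.
    have l : z'.1 @[z' --> (q, (0 : R))] --> q by exact: cvg_fst.
    have UF : U z'.2 @[z' --> (q, (0 : R))] --> u.
      by apply: (cvg_comp snd U) Ucvg; exact: cvg_snd.
    have lB : (z'.1 - z0) @[z' --> (q, (0 : R))] --> q - z0.
      have l0 : z0 @[z' --> (q, (0 : R))] --> z0 by exact: cvg_cst.
      exact: (cvgB l l0).
    have [ltw|gtw|ew] := ltrgtP (cross w q) cw.
    - have H : \forall z' \near (q, (0 : R)), cross w z'.1 < cw.
        exact: (near_cross_lt (cvg_cst w) l ltw).
      by apply: filterS H => z' ?; right; rewrite lt_eqF.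
    - have H : \forall z' \near (q, (0 : R)), cw < cross w z'.1.
        exact: (near_cross_gt (cvg_cst w) l gtw).
      by apply: filterS H => z' ?; right; rewrite gt_eqF.
    case: (ltrgtP (cross u (q - z0)) 0) => [lt|gt|e].
    - have H : \forall z' \near (q, (0 : R)), cross (U z'.2) (z'.1 - z0) < 0.
        exact: (near_cross_lt UF lB lt).
      by apply: filterS H => z' ?; left; rewrite lt_eqF.
    - have H : \forall z' \near (q, (0 : R)), 0 < cross (U z'.2) (z'.1 - z0).
        exact: (near_cross_gt UF lB gt).
      by apply: filterS H => z' ?; left; rewrite gt_eqF.
    exfalso; apply: (Cpk q) => //.
    have -> : q = z; last by [].
    apply: (cross_inj uwn0); last by rewrite ew zc.
    move/eqP: e; rewrite crossDr crossNr subr_eq0 => /eqP ->.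
    by rewrite !flat.
  near=> t => _ t0.
  have n1t : 0 < cross (r *: U t) (y - z0) by near: t.
  have n2t : forall q : 'rV[R]_2, C k q ->
      cross (U t) (q - z0) != 0 \/ cross w q != cw by near: t.
  have rn0 : r != 0.
    by apply/eqP => r0; move/eqP: rr; rewrite r0 mulr0 eq_sym oner_eq0.
  have rU0 : r *: U t != 0 by rewrite scaler_eq0 negb_or rn0 Unz.
  have O1 : Ok k (r *: U t) (cross (r *: U t) z0).
    apply: (C_rotates rU0 u0 (st k kp) Cx xc).
      rewrite -subr_le0 -crossNr -crossDr muE crossZr crossZl cUu.
      have -> : mu * (r * - (sg * t)) = - (order_sign p k * mu * (sg * sg) * t).
        by rewrite /r; ring.
      by rewrite sgg mulr1 oppr_le0 mulr_ge0 // ltW.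
    move=> par q Cq qz qc; apply: (Cpk q) => //.
    have -> : q = z0; last by [].
    by apply: (cross_inj par qz); rewrite qc flat.
  have O2 : Ok k (- (r *: U t)) (- cross (r *: U t) z0).
    apply: (C_rotates _ wn0 sk Cy yc); first by rewrite oppr_eq0.
      rewrite crossNl lerN2 ltW // -subr_gt0 -crossNr -crossDr.
      exact: n1t.
    move=> _ q Cq; rewrite crossNl => /oppr_inj; rewrite !crossZl => /(mulfI rn0) qz qc.
    have [|] := n2t q Cq; first by rewrite crossDr crossNr qz subrr eqxx.
    by rewrite qc eqxx.
  (* The two sides are the right and left ones for [r = 1], and are exchanged for [r = -1]. *)
  have : r = 1 \/ r = -1.
    have /eqP : (r - 1) * (r + 1) = 0.
      by rewrite (_ : _ * _ = r * r - 1); [rewrite rr subrr|ring].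
    by rewrite mulf_eq0 subr_eq0 addr_eq0 => /orP[/eqP|/eqP]; [left|right].
  case=> r1; rewrite r1 in O1 O2.
    by rewrite !scale1r in O1 O2.
  rewrite !scaleN1r !crossNl !opprK in O1 O2.
  by split.
move/nbhs_ballP: near_ord => [e1 /= e10 sub1].
move/nbhs_ballP: near_stab => [e2 /= e20 sub2].
have [t [t0 t1 t2]] : exists t, [/\ 0 < t, t < e1 & t < e2].
  exists (Num.min e1 e2 / 2); have m0 : 0 < Num.min e1 e2 by rewrite lt_min e10.
  have h : Num.min e1 e2 / 2 < Num.min e1 e2 by lra.
  by split; [lra| |]; apply: (lt_le_trans h); rewrite ge_min lexx ?orbT.
have bt e : t < e -> ball (0 : R) e t.
  by move=> te; rewrite /ball /= sub0r normrN gtr0_norm.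
exists (U t); split.
- rewrite cUu oppr_eq0 mulf_neq0 //; last by rewrite gt_eqF.
  by apply/eqP => sg0; move/eqP: sgg; rewrite sg0 mulr0 eq_sym oner_eq0.
- by move=> k kp; apply: (sub2 t (bt _ t2)).
- by move=> i j ij; exact: (sub1 t (bt _ t1) (i, j)).
Unshelve. all: by end_near. Qed.

End Perturbation.

(** * Directed lines *)

Lemma increasing_enumeration (n m : nat) (A : {set 'I_n}) : #|A| = m ->
  exists2 s : 'I_m -> 'I_n, forall a b : 'I_m, (a < b)%N -> (s a < s b)%N &
    forall i, i \in A -> exists a, s a = i.
Proof.
move=> <-; exists (fun a => enum_val a) => [a b ab|i iA]; last first.
  by exists (enum_rank_in iA i); rewrite enum_rankK_in.
have srt : sorted (fun i j : 'I_n => (i < j)%N) (enum A).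
  rewrite /enum_mem sorted_filter //; first by move=> ? ? ?; exact: ltn_trans.
  by have := iota_ltn_sorted 0 n; rewrite -val_enum_ord sorted_map enumT.
have x0 := enum_val a.
rewrite !(enum_val_nth x0).
have := @sorted_ltn_nth _ _ _ x0 _ srt a b.
by rewrite !inE -!cardE !ltn_ord; apply => //; move=> ? ? ?; exact: ltn_trans.
Qed.

Section DirectedLines.
Context {R : realType}.
Implicit Types (C : set 'rV[R]_2) (l : directed_line R).

Lemma right_part_slice l C :
  right_part l C = slice C (dl_dir l) (cross (dl_dir l) (dl_base l)).
Proof.
by apply/seteqP; split=> x [Cx /= h]; split=> //=; move: h;
  rewrite crossDr crossNr subr_le0.
Qed.

Lemma left_part_slice l C :
  left_part l C = slice C (- dl_dir l) (- cross (dl_dir l) (dl_base l)).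
Proof.
by apply/seteqP; split=> x [Cx /= h]; split=> //=; move: h;
  rewrite crossDr crossNr crossNl subr_ge0 lerN2.
Qed.

Lemma fa_stabber_cond f (a : R) C l t : fa_stabber f a C l ->
  C (dl_point l t) ->
  stab_cond C f a (dl_dir l) (cross (dl_dir l) (dl_base l)).
Proof.
move=> [a1 a2] Ct; rewrite left_part_slice in a1; rewrite right_part_slice in a2.
split=> //; exists (dl_point l t); split=> //=.
  by rewrite /dl_point crossDr crossZr crossvv mulr0 addr0.
by rewrite /dl_point crossNl crossDr crossZr crossvv mulr0 addr0.
Qed.

Lemma transversal_of_stabs (n : nat) (C : 'I_n -> set 'rV[R]_2)
    (f : 'I_n -> set 'rV[R]_2 -> R) (alpha : 'I_n -> R) (u : 'rV[R]_2) (c : R) :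
  (forall i, convex_set (C i)) -> u != 0 ->
  (forall i, stab_cond (C i) (f i) (alpha i) u c) ->
  (forall i j : 'I_n, (i < j)%N -> forall x y, C i x -> C j y -> cross u x = cross u y ->
    exists2 k, 0 < k & y - x = k *: u) ->
  exists l, fa_transversal f alpha C l /\ meets_in_order C l.
Proof.
move=> vC u0 st ord; have [w _ uw] := cross_neq0P u0.
exists (DirectedLine (c *: w) u0); split.
  move=> i; have [_ _ a1 a2] := st i; split.
    by rewrite left_part_slice /= crossZr uw mulr1.
  by rewrite right_part_slice /= crossZr uw mulr1.
have /choice[x xP] i : exists x, C i x /\ cross u x = c.
  have [x Cx xc] : exists2 x, C i x & cross u x = c; last by exists x.
  apply: (stab_meets (Ok := side_inc (C i) (f i) (alpha i)) (vC i)).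
    exact: slice_meets.
  exact/stab_incE.
have /choice[t tP] i : exists t, x i = c *: w + t *: u.
  have [|t tE] := @cross_eq0P _ u (x i - c *: w) u0.
    by rewrite crossDr crossNr (xP i).2 crossZr uw mulr1 subrr.
  by exists t; rewrite -tE addrC subrK.
exists t; split=> [i|i j ij]; first by rewrite /dl_point /= -tP; exact: (xP i).1.
have [|k k0 kE] := ord i j ij (x i) (x j) (xP i).1 (xP j).1.
  by rewrite (xP i).2 (xP j).2.
have /eqP : (t j - t i - k) *: u = 0.
  by rewrite !scalerBl -kE !tP; apply: rV2_eq; rewrite !mxE; ring.
by rewrite scaler_eq0 (negbTE u0) orbF subr_eq0 => /eqP; lra.
Qed.

End DirectedLines.

Theorem theorem3p2 (R : realType) (n : nat) (hn : (4 <= n)%N)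
    (C : 'I_n -> set 'rV[R]_2)
    (C_disjoint : forall i j : 'I_n, i != j -> C i `&` C j = set0)
    (C_compact : forall i : 'I_n, compact (C i))
    (C_convex : forall i : 'I_n, convex_set (C i))
    (f : 'I_n -> set 'rV[R]_2 -> R)
    (f_monotone : forall i : 'I_n, convex_monotone (f i))
    (f_continuous : forall i : 'I_n, hausdorff_continuous (f i))
    (alpha : 'I_n -> R)
    (alpha_gt0 : forall i : 'I_n, 0 < alpha i)
    (four : forall s : 'I_4 -> 'I_n,
      (forall a b : 'I_4, (a < b)%N -> (s a < s b)%N) ->
      exists l : directed_line R,
        fa_transversal (fun j => f (s j)) (fun j => alpha (s j))
                       (fun j => C (s j)) l /\
        meets_in_order (fun j => C (s j)) l) :
  exists l : directed_line R, fa_transversal f alpha C l /\ meets_in_order C l.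
Proof.
have /choice[Ok /choice[Ok' OkP]] i := side_conditions_exist (alpha i)
  (C_compact i) (C_convex i) (f_continuous i) (f_monotone i).
have meets i : side_meets (C i) (Ok i) by have [[]] := OkP i.
have rotates i : side_rotates (C i) (Ok i) by have [[]] := OkP i.
have stabE i u c : stab (Ok i) u c <-> stab_cond (C i) (f i) (alpha i) u c.
  by have [[]] := OkP i.
have meets' i : side_meets (C i) (Ok' i) by have [_ []] := OkP i.
have rotates' i : side_rotates (C i) (Ok' i) by have [_ []] := OkP i.
have closed' i : side_closed (C i) (Ok' i) by have [_ []] := OkP i.
have stabW i (u : 'rV[R]_2) c : u != 0 -> stab (Ok i) u c -> stab (Ok' i) u c.
  by have [_ _ h _] := OkP i; exact: h.
have four_stabs (A : {set 'I_n}) : #|A| = 4 -> exists (u : 'rV[R]_2) c,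
    [/\ u != 0, forall i, i \in A -> stab (Ok i) u c &
      forall i j, i \in A -> j \in A -> (i < j)%N -> dir_cone (C i) (C j) u].
  move=> A4; have [s smono sA] := increasing_enumeration A4.
  have [l [trl [t [tC tlt]]]] := four s smono.
  exists (dl_dir l), (cross (dl_dir l) (dl_base l)); split.
  - exact: dl_dir_neq0.
  - move=> i /sA[a <-]; apply/stabE.
    exact: (fa_stabber_cond (trl a) (tC a)).
  move=> _ _ /sA[a <-] /sA[b <-] ab.
  have {}ab : (a < b)%N.
    rewrite ltnNge leq_eqVlt; apply/negP => /orP[/eqP/val_inj e|/smono].
      by rewrite e ltnn in ab.
    by rewrite ltnNge ltnW.
  exists (dl_point l (t a)), (dl_point l (t b)), (t b - t a)^-1.
  have tab : 0 < t b - t a by rewrite subr_gt0 tlt.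
  split; rewrite ?invr_gt0 //; try exact: tC.
  have -> : dl_point l (t b) - dl_point l (t a) = (t b - t a) *: dl_dir l.
    by apply: rV2_eq; rewrite /dl_point !mxE; ring.
  by rewrite scalerA mulVf ?gt_eqF // scale1r.
(* A transversal for the closed conditions, still to be made an actual one. *)
have [|u [c [u0 stab' ord]]] :=
    ordered_transversal hn C_disjoint C_compact C_convex meets' rotates' _ closed'.
  move=> A /four_stabs[u [c [u0 st ord]]]; exists u, c; split=> // i iA.
  by apply: stabW => //; exact: st.
have pointed (i j : 'I_n) : (i < j)%N -> pointed_cone (dir_cone (C i) (C j)).
  by move=> ij; apply: dir_cone_pointed => //; apply/C_disjoint/ltn_ord_neq.
have [all_stab|] := pselect (forall i, stab (Ok i) u c).
  apply: (@transversal_of_stabs _ _ C f alpha u c) => //.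
    by move=> i; apply/stabE.
  move=> i j ij x y Cx Cy; exact: (dir_cone_stab (pointed i j ij) (ord i j ij)).
move=> /existsNP[p nstab].
(* If the line found is not an actual stabber, it is parallel to [d] and therefore contains
   [C i]. *)
have flatP i : ~ stab (Ok i) u c -> exists (d z : 'rV[R]_2), [/\ d != 0,
    forall x, C i x -> cross u x = c,
    forall v b, v != 0 -> stab (Ok i) v b -> cross v d != 0,
    cross u d = 0 &
    C i z /\ forall w, cross w d != 0 -> stab (Ok i) w (cross w z)].
  move=> ns; have [_ _ _ [h|[d [d0 flat npar through]]]] := OkP i.
    by case: ns; apply: h.
  have [z [Cz zc zP]] := through _ _ (stab' i).
  have ud : cross u d = 0.
    by apply: contrapT => /eqP ud; apply: ns; rewrite -zc; exact: zP.
  exists d, z; split=> // x Cx.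
  have [|k kE] := @cross_eq0P _ d (x - z) d0.
    by rewrite crossDr crossNr (flat x z) // subrr.
  by rewrite -zc -[x](subrK z) kE crossDr crossZr ud mulr0 add0r.
have [d [z0 [d0 flat npar ud [Cz0 through]]]] := flatP p nstab.
(* Two pairs sharing [p]; their common stabber links the senses of rotation required by [k] and
   [m]. *)
have pair_stabs k m : k != p -> m != p -> exists (w : 'rV[R]_2) cw, [/\ w != 0,
    stab (Ok p) w cw, stab (Ok k) w cw, stab (Ok m) w cw &
    before C p k w /\ before C p m w].
  move=> kp mp.
  have sorted_pair q : q != p -> exists i j : 'I_n, [/\ (i < j)%N,
      p \in [:: i; j], q \in [:: i; j] &
      forall w, dir_cone (C i) (C j) w -> before C p q w].
    move=> qp; rewrite /before; case: (ltngtP p q) => [pq|pq|/val_inj e].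
    - by exists p, q; rewrite !inE !eqxx orbT.
    - by exists q, p; rewrite !inE !eqxx orbT.
    - by rewrite e eqxx in qp.
  have [i [j [ij pij kij bk]]] := sorted_pair k kp.
  have [i' [j' [ij' pij' mij' bm]]] := sorted_pair m mp.
  have [w [cw [w0 st Dij Dij']]] := two_pairs hn four_stabs ij ij'.
  exists w, cw; split=> //; last by split; [exact: bk|exact: bm].
  - by apply: st; move: pij; rewrite !inE => /orP[] ->; rewrite ?orbT.
  - by apply: st; move: kij; rewrite !inE => /orP[] ->; rewrite ?orbT.
  - by apply: st; move: mij'; rewrite !inE => /orP[] ->; rewrite ?orbT.
have uw_neq0 (w : 'rV[R]_2) cw : w != 0 -> stab (Ok p) w cw -> cross u w != 0.
  move=> w0 sp; apply/eqP => uw.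
  have [k kE] := cross_eq0P u0 uw.
  by move: (npar w cw w0 sp); rewrite kE crossZl ud mulr0 eqxx.
(* Two sets contained in the same line would both meet a common stabber at its only point on that
   line, against disjointness. *)
have others k : k != p -> stab (Ok k) u c.
  move=> kp; apply: contrapT => /flatP[_ [_ [_ flatk _ _ _]]].
  have [w [cw [w0 sp sk _ _]]] := pair_stabs k k kp kp.
  have [x Cx xc] := stab_meets (C_convex p) (meets p) sp.
  have [y Cy yc] := stab_meets (C_convex k) (meets k) sk.
  have e : x = y.
    apply: (cross_inj (uw_neq0 w cw w0 sp)); last by rewrite xc yc.
    by rewrite flat // flatk.
  have : (C k `&` C p) y by split=> //; rewrite -e.
  by rewrite C_disjoint.
(* If turning left is impossible for some [m], then for every [k] the stabber common to [p], [k] and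
   [m] turns right. *)
have [sg sgg pairs] : exists2 sg : R, sg * sg = 1 & forall k, k != p ->
    exists w cw, [/\ stab (Ok p) w cw, stab (Ok k) w cw, before C p k w
      & 0 < sg * cross u w].
  have [h|] := pselect (forall k, k != p -> exists w cw, [/\ stab (Ok p) w cw,
      stab (Ok k) w cw, before C p k w & 0 < 1 * cross u w]).
    by exists 1; rewrite ?mulr1.
  move=> /existsNP[m /not_implyP[mp nm]]; exists (-1); first by rewrite mulrNN mulr1.
  move=> k kp; have [w [cw [w0 sp sk sm [bk bm]]]] := pair_stabs k m kp mp.
  exists w, cw; split=> //; rewrite mulN1r oppr_gt0 lt_neqAle.
  rewrite (uw_neq0 w cw) //= leNgt; apply/negP => lt.
  by apply: nm; exists w, cw; rewrite mul1r.
have [v [vu stv ordv]] := rotate_transversal C_disjoint C_compact C_convex meets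
  rotates u0 Cz0 flat others ord sgg pairs.
have v0 : v != 0 by apply: contra vu => /eqP ->; rewrite cross0l.
apply: (@transversal_of_stabs _ _ C f alpha v (cross v z0)) => // i.
apply/stabE; have [->|] := eqVneq i p; last exact: stv.
apply: through; apply: contra vu => /eqP vd.
have [|k kE] := @cross_eq0P _ d u d0; first by rewrite crossC ud oppr0.
by rewrite kE crossZr vd mulr0.
Qed.
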